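(* Let $k\ge6$ be an integer and let $n$ be sufficiently large (depending on $k$) and admissible, with $t=2(n-2)/(k-2)$. If $t$ is even, there are exactly $\lfloor\frac{k-2}{2}\rfloor$ pairwise nonisomorphic planar $k$-uniform hypergraphs on $n$ vertices of maximum spectral radius (among all planar $k$-uniform hypergraphs on $n$ vertices); if $t$ is odd, there is exactly one up to isomorphism.
   Context: For an integer $k\ge3$, a closed $k$-angulation is a simple $2$-connected plane graph all of whose faces, the outer face included, are bounded by cycles of length $k$; on $n$ vertices it has $2(n-2)/(k-2)$ faces. Its face hypergraph is the $k$-uniform hypergraph on its vertex set whose edges are the vertex sets of all its faces. For $k\ge4$, a $k$-uniform hypergraph is planar if it is the face hypergraph of a closed $k$-angulation. An integer $n\ge k$ is admissible if $2(n-2)/(k-2)$ is an integer. The spectral radius of a $k$-uniform hypergraph $\mathcal H$ on $n$ vertices is $$\lambda(\mathcal H)=\max\Bigl\{P_{\mathcal H}(x): x\in\mathbb R_{\ge0}^n,\ \sum_v x_v^k=1\Bigr\},\qquad P_{\mathcal H}(x)=k\sum_{e\in E(\mathcal H)}\prod_{v\in e}x_v .$$ *)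

(* Defs.v *)
From mathcomp Require Import all_boot all_order all_algebra perm.
From mathcomp Require Import all_classical all_reals all_analysis.
Import Order.TTheory GRing.Theory Num.Theory.
Import numFieldNormedType.Exports.

Set Implicit Arguments.
Unset Strict Implicit.
Unset Printing Implicit Defensive.

Local Open Scope ring_scope.

(* A finite simple graph embedded in an oriented closed surface, given by its
   rotation system: [rot v] permutes the neighbours of [v] in a single cycle,
   namely their cyclic order around [v].  The values of [rot v] at
   non-neighbours of [v] play no role. *)
Record embedded_graph (n : nat) := EmbeddedGraph {
  adj : rel 'I_n;
  adj_sym : symmetric adj;
  adj_irr : irreflexive adj;
  rot : 'I_n -> {perm 'I_n};
  rot_cyclic : forall v a b : 'I_n,
    adj v a -> (b \in porbit (rot v) a) = adj v b
}.

Section PlaneGraphs.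
Variables (n : nat) (G : embedded_graph n).

(* A dart (u, v) is the edge uv traversed from u to v. *)
Definition darts : {set 'I_n * 'I_n} := [set d | adj G d.1 d.2].

Definition edges : {set {set 'I_n}} := [set [set d.1; d.2] | d in darts].

(* Face tracing: having arrived at v from u, leave v along the edge following
   vu in the rotation at v.  The faces are the orbits of darts under this map. *)
Definition face_next (d : 'I_n * 'I_n) : 'I_n * 'I_n := (d.2, rot G d.2 d.1).

Definition faces : {set {set 'I_n * 'I_n}} :=
  [set [set d' in orbit face_next d] | d in darts].

(* The closed walk of G bounding the face that contains the dart d. *)
Definition face_walk (d : 'I_n * 'I_n) : seq 'I_n :=
  [seq d'.1 | d' <- orbit face_next d].

Definition connected_off (X : {set 'I_n}) : Prop :=
  forall x y : 'I_n, x \notin X -> y \notin X ->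
    connect [rel a b | [&& adj G a b, a \notin X & b \notin X]] x y.

Definition two_connected : Prop :=
  (2 < n)%N /\ forall X : {set 'I_n}, (#|X| < 2)%N -> connected_off X.

(* The surface of a connected embedded graph is the sphere iff its Euler
   characteristic V - E + F is 2. *)
Definition plane : Prop :=
  connected_off finset.set0 /\ (n + #|faces| = #|edges| + 2)%N.

Definition closed_angulation (k : nat) : Prop :=
  [/\ plane, two_connected &
      forall d, d \in darts ->
        ucycle (adj G) (face_walk d) /\ size (face_walk d) = k].

End PlaneGraphs.

Definition hypergraph (n : nat) := {set {set 'I_n}}.

Definition face_hypergraph (n : nat) (G : embedded_graph n) : hypergraph n :=
  [set [set v in face_walk G d] | d in darts G].

Definition planar_hypergraph (k n : nat) (H : hypergraph n) : Prop :=
  exists G : embedded_graph n, closed_angulation G k /\ H = face_hypergraph G.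

Definition isomorphic (n : nat) (H1 H2 : hypergraph n) : Prop :=
  exists p : {perm 'I_n}, [set p @: e | e : {set 'I_n} in H1] = H2.

Definition admissible (k n : nat) : bool :=
  (k <= n)%N && (k - 2 %| 2 * (n - 2))%N.

Section SpectralRadius.
Variables (R : realType) (k n : nat).

Definition hyper_form (H : hypergraph n) (x : 'rV[R]_n) : R :=
  k%:R * \sum_(e in H) \prod_(v in e) x ord0 v.

Definition unit_nonneg : set 'rV[R]_n :=
  [set x | (forall v, 0 <= x ord0 v) /\ \sum_v x ord0 v ^+ k = 1]%classic.

(* The supremum is a maximum, see [spectral_radius_max]. *)
Definition spectral_radius (H : hypergraph n) : R :=
  sup [set hyper_form H x | x in unit_nonneg]%classic.

Lemma hyper_form_continuous (H : hypergraph n) : continuous (hyper_form H).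
Proof.
pose S (x : 'rV[R]_n) : R := \sum_(e in H) \prod_(v in e) x ord0 v.
suff cS : continuous S.
  move=> x; apply: (@continuous_comp _ _ _ S (fun y : R => k%:R * y)).
    exact: cS.
  exact: mulrl_continuous.
apply: continuous_big => [|e _]; first exact: add_continuous.
apply: continuous_big => [|v _]; first exact: mul_continuous.
exact: coord_continuous.
Qed.

Lemma unit_nonneg_neq0 : (0 < k)%N -> (0 < n)%N -> (unit_nonneg !=set0)%classic.
Proof.
move=> k0 n0; exists (\row_v (v == Ordinal n0)%:R); split=> [v|].
  by rewrite mxE ler0n.
rewrite (bigD1 (Ordinal n0)) //= mxE eqxx expr1n big1 ?addr0 // => v vN.
by rewrite mxE (negPf vN) expr0n eqn0Ngt k0.
Qed.

Lemma unit_nonneg_compact : (0 < k)%N -> compact unit_nonneg.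
Proof.
move=> k0; pose A := [set x : 'rV[R]_n | forall v, `[0, 1]%classic (x ord0 v)]%classic.
pose B := ((fun x : 'rV[R]_n => \sum_v x ord0 v ^+ k) @^-1` [set x | x = 1])%classic.
have -> : unit_nonneg = (A `&` B)%classic.
  apply/seteqP; split=> x /= [x0 x1]; split=> // v; last first.
    by have := x0 v; rewrite /= in_itv /= => /andP[].
  rewrite /= in_itv /= x0 /= -(@expr_le1 _ k) // -x1 (bigD1 v) //= lerDl.
  by apply: sumr_ge0 => w _; exact: exprn_ge0.
apply: compact_closedI; first exact: (rV_compact (fun=> @segment_compact R 0 1)).
apply: preimage_closed; last exact: closed_eq.
move=> x _; move: x; apply: continuous_big => [|v _]; first exact: add_continuous.
move=> x; apply: (@continuous_comp _ _ _ (fun y : 'rV[R]_n => y ord0 v) (fun t : R => t ^+ k)).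
  exact: coord_continuous.
exact: exprn_continuous.
Qed.

Lemma spectral_radius_max (H : hypergraph n) : (0 < k)%N -> (0 < n)%N ->
  exists2 x, unit_nonneg x & hyper_form H x = spectral_radius H /\
    forall y, unit_nonneg y -> hyper_form H y <= spectral_radius H.
Proof.
move=> k0 n0; have U0 := unit_nonneg_neq0 k0 n0.
have [x + xmax] := EVT_max_rV U0 (unit_nonneg_compact k0)
  (continuous_subspaceT (@hyper_form_continuous H)).
rewrite inE => Ux; have xub y : unit_nonneg y -> hyper_form H y <= hyper_form H x.
  by move=> Uy; apply: xmax; rewrite inE.
have -> : spectral_radius H = hyper_form H x.
  apply/eqP; rewrite eq_le; apply/andP; split.
    by apply: ge_sup => [|_ [y Uy <-]]; [exists (hyper_form H x), x | exact: xub].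
  apply: ub_le_sup; last by exists x.
  by exists (hyper_form H x) => _ [y Uy <-]; exact: xub.
by exists x.
Qed.

End SpectralRadius.

Definition spectral_maximum (R : realType) (k n : nat) (H : hypergraph n) : Prop :=
  planar_hypergraph k H /\
  forall H' : hypergraph n, planar_hypergraph k H' ->
    spectral_radius R k H' <= spectral_radius R k H.

Definition exactly_up_to_iso (n m : nat) (Q : hypergraph n -> Prop) : Prop :=
  exists F : 'I_m -> hypergraph n,
    [/\ forall i, Q (F i),
        forall i j, isomorphic (F i) (F j) -> i = j &
        forall H, Q H -> exists i, isomorphic H (F i)].

(* Main.v *)
Require Import Defs.
From mathcomp Require Import all_boot all_order all_algebra perm.
From mathcomp Require Import all_classical all_reals all_analysis.
From mathcomp Require Import zify ring lra.
Import Order.TTheory GRing.Theory Num.Theory.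

(* In a plane graph, a set S of at least 2 vertices satisfies
   sum_F max(0, |F :&: S| - 2) <= 2 (|S| - 2), the sum being over the faces F,
   because the vertex-face incidence graph is planar and bipartite.  Order the
   vertices by decreasing weight x_v, with u, w the first two, and call the first
   two vertices of each face its hubs.  Abel summation turns the inequality into
   sum_F sum_(v in F not hub) x_v^k <= 2 sum_(v <> u, w) x_v^k.  The AM-GM
   inequality on each face, normalized so that it is tight when hubs have
   x_v^k = 1/k and the other vertices x_v^k = 2/(kt), then yields the sharp bound
   P(x) <= 2^(1-2/k) t^(2/k), and equality forces u and w to lie on all faces.
   All other vertices then have degree 2, so G consists of t paths from u to w,
   and since any two consecutive paths bound a face of length k, their lengths
   are alternately a and k - a.  All these graphs attain the bound, and the
   hypergraph determines the pair {a, k - a}; if t is odd, then a = k - a. *)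

Set Implicit Arguments.
Unset Strict Implicit.
Unset Printing Implicit Defensive.

(** * Vertex-face incidences in plane graphs *)

(** Planarity is given as Euler's formula for a connected rotation system, so no curves are
    available, and passing to a subgraph by deletions would mean rebuilding rotations and faces. The
    bound 2v - 4 for induced subgraphs of the vertex-face graph is therefore obtained by linear
    algebra over the rationals: Euler's inequality for the subgraph becomes a dimension count, in
    which cuts are orthogonal to boundaries and to cycles. The normalization of AM-GM is dictated by
    the extremal vector: two hubs of weight 1/k contribute 2/k, and the n - 2 = t(k-2)/2 other
    vertices, of weight 2/(kt), contribute (k-2)/k. The resulting bound depends on k and t but not
    on a, which is why several hypergraphs tie. The parameter a starts at 2, because lengths recur
    two paths later and a second path of length 1 would be a parallel edge; so 2 <= a <= k/2, which
    leaves floor((k-2)/2) values. *)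

Section LinearAlgebra.
Local Open Scope ring_scope.

(** Unknowns and equations are indexed by arbitrary finite types, so that the mixed system of
    [corners_regions] can be set up on sum types. *)
Lemma nontrivial_solution (K : fieldType) (I J : finType) (L : J -> I -> K) :
  (#|J| < #|I|)%N ->
  exists2 g : I -> K, exists i, g i != 0 & forall j, \sum_i L j i * g i = 0.
Proof.
move=> ltJI; pose M := \matrix_(i < #|I|, j < #|J|) L (enum_val j) (enum_val i).
have : kermx M != 0.
  rewrite -mxrank_eq0 mxrank_ker -lt0n subn_gt0.
  exact: leq_ltn_trans (rank_leq_col M) ltJI.
case/rowV0Pn => w /sub_kermxP wM w0; exists (fun i => w ord0 (enum_rank i)).
  move/rV0Pn: w0 => [i wi]; exists (enum_val i).
  by rewrite enum_valK.
move=> j; have := congr1 (fun A : 'rV_#|J| => A ord0 (enum_rank j)) wM.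
rewrite !mxE (reindex (@enum_rank I)) /=; last first.
  by exists enum_val => i _; rewrite ?enum_rankK ?enum_valK.
by move=> wM0; rewrite -[RHS]wM0; apply: eq_bigr => i _; rewrite mxE !enum_rankK mulrC.
Qed.

Lemma sum_indicator (K : pzRingType) (I : finType) (x : I) (g : I -> K) :
  \sum_i (x == i)%:R * g i = g x.
Proof.
rewrite (bigD1 x) //= eqxx mul1r big1 ?addr0 // => i.
by rewrite eq_sym => /negPf->; rewrite mul0r.
Qed.

Lemma sum_by_fiber (K : pzRingType) (I J : finType) (k : I -> J) (h : J -> K) (g : I -> K) :
  \sum_i h (k i) * g i = \sum_j h j * \sum_(i | k i == j) g i.
Proof.
rewrite (partition_big k xpredT) //=; apply: eq_bigr => j _.
by rewrite big_distrr /=; apply: eq_bigr => i /eqP->.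
Qed.

End LinearAlgebra.

(* [D] is the set of corners of a map on the sphere, i.e. of edges of its
   bipartite vertex-face incidence graph.  The faces of that graph are
   quadrilaterals, one for each edge of the map, and [e1 c], [e2 c] are the two
   quadrilaterals on either side of the corner [c]. *)
Section SphericalIncidences.
Local Open Scope ring_scope.
Variables (V F E D : finType) (v : D -> V) (f : D -> F) (e1 e2 : D -> E) (v0 : V).
Hypothesis corner_inj : forall c c', v c = v c' -> f c = f c' -> c = c'.
(** Each edge met while turning around a vertex or a face is [e1] of one corner and [e2] of a
    neighbouring one, so the differences telescope: the boundary of a combination of quadrilaterals
    is a cycle. *)
Hypothesis quad_v : forall (a : E -> rat) x,
  \sum_(c | v c == x) (a (e1 c) - a (e2 c)) = 0.
Hypothesis quad_f : forall (a : E -> rat) y,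
  \sum_(c | f c == y) (a (e1 c) - a (e2 c)) = 0.
(** Connectivity of the incidence graph and, in [connected_e], of its dual, stated as the triviality
    of the kernels that the dimension count meets. *)
Hypothesis connected_vf : forall (p : V -> rat) (q : F -> rat),
  (forall c, p (v c) + q (f c) = 0) -> p v0 = 0 ->
  (forall x, p x = 0) /\ (forall y, q y = 0).
Hypothesis connected_e : forall (a : E -> rat),
  (forall c, a (e1 c) = a (e2 c)) -> forall e e', a e = a e'.
Hypothesis euler : (#|D| + 2 = #|V| + #|F| + #|E|)%N.

Variable W : {set V + F}.
Hypothesis W3 : (2 < #|W|)%N.

(** [C] is the edge set of the subgraph induced by [W] in the incidence graph. Quadrilaterals glued
    across the corners outside [C] merge into the faces of this subgraph, and [regions] holds one
    root for each. *)
Let C := [set c | (inl (v c) \in W) && (inr (f c) \in W)].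
Let glued : rel E := [rel x y | [exists c, (c \notin C) &&
  (((e1 c == x) && (e2 c == y)) || ((e1 c == y) && (e2 c == x)))]].

Let glued_sym : connect_sym glued.
Proof.
by apply: sym_connect_sym => x y /=; apply: eq_existsb => c; rewrite orbC.
Qed.

Let region := fingraph.root glued.
Let regions := [set e | roots glued e].

Let regionE c : c \notin C -> region (e1 c) = region (e2 c).
Proof.
move=> cC; apply/eqP; rewrite root_connect //; apply: connect1.
by apply/existsP; exists c; rewrite cC !eqxx.
Qed.

(** Cuts are orthogonal to boundaries. The graph being bipartite, a change of sign on [F] turns the
    difference in a coboundary into the sum [p + q]. *)
Let orthogonal (p : V -> rat) (q : F -> rat) (a : E -> rat) :
  \sum_c (p (v c) + q (f c)) * (a (e1 c) - a (e2 c)) = 0.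
Proof.
under eq_bigr do rewrite mulrDl.
rewrite big_split /= (sum_by_fiber v p) (sum_by_fiber f q) !big1 ?addr0 // => x _.
  by rewrite quad_f mulr0.
by rewrite quad_v mulr0.
Qed.

(* By dimension count the homogeneous system [p(v c) + q(f c) + (a(e1 c) - a(e2 c)) + G c = 0],
   with [G] a cycle supported on [C], [p v0 = 0] and [a = 0] at the root of each
   region, would otherwise have a nonzero solution; but [p + q] is orthogonal to
   the two other terms, so all of them vanish. *)
Let corners_regions : (#|C| + 2 <= #|W| + #|regions|)%N.
Proof.
have [w0 w0W] : exists w0, w0 \in W by apply/card_gt0P; lia.
rewrite leqNgt; apply/negP => ltC.
(* By [euler] there are |D| + 2 + |C| unknowns, against |D| + |regions| + |W| equations: one per
   corner, the normalizations at [v0] and at the roots, and conservation of [G] at every element of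
   [W] but [w0]. *)
pose I : finType := ((V + F) + (E + {c | c \in C}))%type.
pose J : finType := (D + unit + ({e | e \in regions} + {w | w \in W :\ w0}))%type.
pose L (j : J) (i : I) : rat := match j, i with
  | inl (inl c), inl (inl x) => (v c == x)%:R
  | inl (inl c), inl (inr y) => (f c == y)%:R
  | inl (inl c), inr (inl e) => (e1 c == e)%:R - (e2 c == e)%:R
  | inl (inl c), inr (inr c') => (val c' == c)%:R
  | inl (inr _), inl (inl x) => (v0 == x)%:R
  | inr (inl r), inr (inl e) => (val r == e)%:R
  | inr (inr w), inr (inr c') =>
      (inl (v (val c')) == val w)%:R + (inr (f (val c')) == val w)%:R
  | _, _ => 0
  end.
have ltJI : (#|J| < #|I|)%N.
  have := cardsD1 w0 W; rewrite w0W => W1.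
  have cardE (T : finType) (A : {set T}) : #|[pred x in A]| = #|A| by exact: eq_card.
  rewrite !card_sum !card_sig card_unit !cardE.
  lia.
have [g [i gi] gL] := nontrivial_solution L ltJI.
pose p x := g (inl (inl x)); pose q y := g (inl (inr y)).
pose a e := g (inr (inl e)).
pose G c := if insub c is Some c' then g (inr (inr c')) else 0.
have GC c : c \notin C -> G c = 0 by move=> cC; rewrite /G insubN.
have GE (h : D -> rat) : \sum_(c' : {c | c \in C}) h (val c') * g (inr (inr c')) = \sum_c h c * G c.
  rewrite [RHS](bigID (mem C)) /= [X in _ = _ + X]big1 ?addr0; last first.
    by move=> c cC; rewrite GC ?mulr0.
  rewrite (reindex_omap (val : {c | c \in C} -> D) insub) /=; last first.
    by move=> c cC; rewrite insubT.
  apply: eq_big => [c'|c' _]; first by rewrite valK eqxx (valP c').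
  by rewrite /G valK.
have eqD c : p (v c) + q (f c) + (a (e1 c) - a (e2 c)) + G c = 0.
  rewrite -[RHS](gL (inl (inl c))) !big_sumType /= !sum_indicator.
  rewrite (GE (fun c' => (c' == c)%:R)) -[LHS]addrA; congr (_ + (_ + _)).
    rewrite -[a (e1 c)](sum_indicator (e1 c)) -[a (e2 c)](sum_indicator (e2 c)) -sumrB.
    by apply: eq_bigr => e _; rewrite mulrBl.
  by rewrite -[LHS](sum_indicator c); apply: eq_bigr => c' _; rewrite eq_sym.
have sum0 (T : finType) (h : T -> rat) : \sum_i 0 * h i = 0.
  by apply: big1 => i' _; rewrite mul0r.
have pv0 : p v0 = 0.
  have := gL (inl (inr tt)); rewrite !big_sumType /= sum_indicator.
  by rewrite !sum0 !addr0.
have a_region r : r \in regions -> a r = 0.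
  move=> rR; have := gL (inr (inl (exist _ r rR))).
  rewrite !big_sumType /= sum_indicator.
  by rewrite !sum0 !addr0 add0r.
pose node w := \sum_c ((inl (v c) == w)%:R + (inr (f c) == w)%:R) * G c.
have node_v x : node (inl x) = \sum_(c | v c == x) G c.
  rewrite /node [RHS]big_mkcond /=; apply: eq_bigr => c _.
  by rewrite (inj_eq (@inl_inj _ _)) /= addr0; case: ifP; rewrite ?mul1r ?mul0r.
have node_f y : node (inr y) = \sum_(c | f c == y) G c.
  rewrite /node [RHS]big_mkcond /=; apply: eq_bigr => c _.
  by rewrite (inj_eq (@inr_inj _ _)) /= add0r; case: ifP; rewrite ?mul1r ?mul0r.
have node0' w : w != w0 -> node w = 0.
  move=> ww0; have [wW|wW] := boolP (w \in W).
    have wW0 : w \in W :\ w0 by rewrite !inE ww0.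
    have := gL (inr (inr (exist _ w wW0))).
    rewrite !big_sumType /= (GE (fun c => (inl (v c) == w)%:R + (inr (f c) == w)%:R)).
    by rewrite !sum0 !add0r.
  apply: big1 => c _; have [cC|/GC->] := boolP (c \in C); last by rewrite mulr0.
  move: cC; rewrite inE => /andP[vW fW].
  have [/eqP vw|_] := boolP (_ == w); first by rewrite vw (negPf wW) in vW.
  have [/eqP fw|_] := boolP (_ == w); first by rewrite fw (negPf wW) in fW.
  by rewrite addr0 mul0r.
(* The conservation law omitted at [w0] follows from the others, because the flow summed over the
   vertices and the flow summed over the faces are the same total. *)
have node_sum : \sum_x node (inl x) = \sum_y node (inr y).
  transitivity (\sum_c G c).
    by rewrite (partition_big v xpredT) //=; apply: eq_bigr => x _; rewrite node_v.
  by rewrite (partition_big f xpredT) //=; apply: eq_bigr => y _; rewrite node_f.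
have node0 w : node w = 0.
  have [->|/node0' //] := eqVneq w w0.
  move: node_sum node0'; case: (w0) => [x|y] ns n0.
    move: ns; rewrite (bigD1 x) //= !big1 ?addr0 // => i' => [_|ix]; apply: n0 => //.
  move: ns; rewrite (bigD1 y) //= !big1 ?addr0 // => i' => [iy|_]; apply: n0 => //.
have orthG : \sum_c (p (v c) + q (f c)) * G c = 0.
  under eq_bigr do rewrite mulrDl.
  rewrite big_split /= (sum_by_fiber v p) (sum_by_fiber f q) !big1 ?addr0 // => x _.
    by rewrite -node_f node0 mulr0.
  by rewrite -node_v node0 mulr0.
have pq0 c : p (v c) + q (f c) = 0.
  have : \sum_c (p (v c) + q (f c)) ^+ 2 = 0.
    transitivity (\sum_c (p (v c) + q (f c)) * - ((a (e1 c) - a (e2 c)) + G c)).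
      apply: eq_bigr => c' _; rewrite expr2; congr (_ * _).
      by apply/eqP; rewrite -addr_eq0 addrA eqD.
    under eq_bigr do rewrite mulrN mulrDr.
    by rewrite sumrN big_split /= orthogonal orthG addr0 oppr0.
  move/psumr_eq0P => /(_ (fun c _ => sqr_ge0 _) c isT) /eqP.
  by rewrite sqrf_eq0 => /eqP.
have [p0 q0] := connected_vf pq0 pv0.
have aG c : a (e1 c) - a (e2 c) + G c = 0 by have := eqD c; rewrite pq0 add0r.
(* Off [C] the equation makes [a] agree on both sides of a corner, so [a] is constant on each region
   and equal to its value 0 at the root. *)
have a0 e : a e = 0.
  rewrite -(a_region (region e)); last by rewrite inE roots_root.
  have : connect glued e (region e) by exact: connect_root.
  case/connectP=> s + ->; elim: s e => [//|e' s IHs] e /= /andP[/existsP[c /andP[cC ee']] es].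
  rewrite -(IHs e') //; have := aG c; rewrite GC // addr0 => /eqP; rewrite subr_eq0.
  by case/orP: ee' => /andP[/eqP-> /eqP->] /eqP->.
have G0 c : G c = 0 by have := aG c; rewrite !a0 subrr add0r.
case: i gi => [[x|y]|[e|c]]; rewrite -?/(p _) -?/(q _) -?/(a _) ?p0 ?q0 ?a0 ?eqxx //.
by have := G0 (val c); rewrite /G valK => ->; rewrite eqxx.
Qed.

Let frontier e := [set c in C | (region (e1 c) == e) != (region (e2 c) == e)].

(* The boundary of a region is a nonzero cycle of a simple bipartite graph. *)
Let frontier4 e : e \in regions -> (1 < #|regions|)%N -> (4 <= #|frontier e|)%N.
Proof.
(* [z] is the boundary of the indicator of the region. Were it zero, connectivity of the dual would
   make the indicator constant, although there is a second region. *)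
move=> eR R2; pose a x : rat := (region x == e)%:R.
pose z c := a (e1 c) - a (e2 c).
have zN c : z c != 0 -> c \in frontier e.
  rewrite /z /a inE => zc; rewrite -[_ \in C]negbK; apply/andP; split.
    by apply/negP => cC; move: zc; rewrite (regionE cC) subrr eqxx.
  by apply: contra_neq zc => ->; rewrite subrr.
have [c1 zc1] : exists c, z c != 0.
  apply/existsP; rewrite -[X in is_true X]negbK negb_exists; apply/negP => /forallP z0.
  have aE c : a (e1 c) = a (e2 c).
    by have := z0 c; rewrite negbK subr_eq0 => /eqP.
  have /card_gt0P[e'] : (0 < #|regions :\ e|)%N.
    by have := cardsD1 e regions; rewrite eR; lia.
  rewrite 3!inE => /andP[e'e re']; have := connected_e aE e e'; rewrite /a.
  move: eR; rewrite inE => /eqP; rewrite -/(region e) => ->.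
  move: re' => /eqP; rewrite -/(region e') => ->.
  by rewrite eqxx (negPf e'e).
have another (T : finType) (h : D -> T) c : (forall y, \sum_(c | h c == y) z c = 0) ->
    z c != 0 -> exists c', [/\ c' != c, h c' = h c & z c' != 0].
  move=> hz zc; have := hz (h c); rewrite (bigD1 c) //= => /eqP s0.
  have : \sum_(c' | (h c' == h c) && (c' != c)) z c' != 0.
    by apply: contra_neq zc => s1; move: s0; rewrite s1 addr0 => /eqP.
  case: (pickP (fun c' => [&& h c' == h c, c' != c & z c' != 0])) => [c' /and3P[/eqP h1 h2 h3]|N].
    by exists c'.
  rewrite big1 ?eqxx // => c' /andP[h1 h2]; apply/eqP.
  by have := N c'; rewrite h1 h2 /= => /negbFE.
have zv y : \sum_(c | v c == y) z c = 0 by exact: quad_v.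
have zf y : \sum_(c | f c == y) z c = 0 by exact: quad_f.
(* Follow the cycle from [c1] in both directions: [c2] shares its vertex, [c3] its face, and [c4]
   the face of [c2]. The faces of [c1] and [c2] differ by [corner_inj], so the four corners are
   distinct. *)
have [c2 [c21 v21 zc2]] := another _ v c1 zv zc1.
have [c3 [c31 f31 zc3]] := another _ f c1 zf zc1.
have [c4 [c42 f42 zc4]] := another _ f c2 zf zc2.
have f21 : f c2 != f c1.
  by apply: contra_neq c21 => fE; exact: corner_inj.
have c23 : c2 != c3 by apply: contra_neq f21 => ->.
have c41 : c4 != c1 by apply: contra_neq f21 => cE; rewrite -f42 cE.
have c43 : c4 != c3 by apply: contra_neq f21 => cE; rewrite -f42 cE.
have /subset_leq_card : [set:: [:: c1; c2; c3; c4]] \subset frontier e.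
  apply/fintype.subsetP => c; rewrite !inE.
  by case/or4P => /eqP->; have := zN _ zc1; have := zN _ zc2; have := zN _ zc3; have := zN _ zc4; rewrite !inE.
apply: leq_trans; rewrite cardsE.
have /card_uniqP-> // : uniq [:: c1; c2; c3; c4].
rewrite /= !inE !negb_or /=; apply/and3P; split=> //.
- by rewrite ![c1 == _]eq_sym c21 c31 c41.
- by rewrite c23 eq_sym.
- by rewrite eq_sym c43.
Qed.

(** Every region has at least four frontier corners and a corner is on at most two frontiers, so
    4|regions| <= 2|C|; combine with Euler's inequality. With a single region, that inequality and
    |W| >= 3 suffice. *)
Lemma planar_bipartite_edges : (#|C| + 4 <= 2 * #|W|)%N.
Proof.
have [R2|] := ltnP 1 #|regions|; last by have := corners_regions; lia.
suff : (4 * #|regions| <= 2 * #|C|)%N by have := corners_regions; lia.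
have : (\sum_(e in regions) 4 <= \sum_(e in regions) #|frontier e|)%N.
  by apply: leq_sum => e eR; exact: frontier4.
rewrite sum_nat_const mulnC => /leq_trans; apply.
have -> : (\sum_(e in regions) #|frontier e| =
   \sum_(c in C) \sum_(e in regions) ((region (e1 c) == e) != (region (e2 c) == e)))%N.
  rewrite exchange_big /=; apply: eq_bigr => e _.
  rewrite -sum1dep_card big_mkcondr /=; apply: eq_bigr => c _.
  by case: (_ != _).
rewrite mulnC -sum_nat_const; apply: leq_sum => c _.
have sumle (e : E) : (\sum_(e' in regions) (e == e') <= 1)%N.
  rewrite -big_mkcondr /= sum1dep_card.
  rewrite -(cards1 e); apply: subset_leq_card; apply/fintype.subsetP => e'.
  by rewrite !inE => /andP[_ /eqP->].
apply: (@leq_trans (\sum_(e in regions) ((region (e1 c) == e) + (region (e2 c) == e)))%N).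
  by apply: leq_sum => e _; case: (region (e1 c) == e); case: (region (e2 c) == e).
by rewrite big_split /=; have := sumle (region (e1 c)); have := sumle (region (e2 c)); lia.
Qed.

End SphericalIncidences.

(** * Darts, rotations and faces of a rotation system *)

Section EmbeddedGraphs.
Variables (n : nat) (G : embedded_graph n).

Lemma adj_rot v a : adj G v a -> adj G v (Defs.rot G v a).
Proof. by move=> va; rewrite -(rot_cyclic _ va) -[Defs.rot G v a]/((Defs.rot G v ^+ 1)%g a) mem_porbit. Qed.

Lemma adj_rotV v a : adj G v a -> adj G v ((Defs.rot G v)^-1%g a).
Proof.
by move=> va; rewrite -(rot_cyclic _ va) -porbitV -[_ a]/(((Defs.rot G v)^-1 ^+ 1)%g a) mem_porbit.
Qed.

Lemma rot_ind (P : 'I_n -> Prop) v a b :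
  (forall c, adj G v c -> P c -> P (Defs.rot G v c)) ->
  adj G v a -> adj G v b -> P a -> P b.
Proof.
move=> IH va; rewrite -(rot_cyclic _ va) => /porbitP[i ->] Pa.
suff [] : adj G v ((Defs.rot G v ^+ i)%g a) /\ P ((Defs.rot G v ^+ i)%g a) by [].
elim: i => [|i [adjI PI]]; first by rewrite expg0 perm1.
by rewrite expgSr permM; split; [exact: adj_rot | exact: IH].
Qed.

Lemma face_next_inj : injective (face_next G).
Proof. by move=> [a b] [c d] [<- /perm_inj <-]. Qed.

Lemma face_next_dart d : (face_next G d \in darts G) = (d \in darts G).
Proof.
case: d => a b; rewrite !inE /= adj_sym; apply/idP/idP => [|ab].
  rewrite adj_sym => /adj_rotV; rewrite permK adj_sym //.
by rewrite adj_sym adj_rot // adj_sym.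
Qed.

Definition face_of d := [set d' in orbit (face_next G) d].

Lemma mem_face_of d d' : (d' \in face_of d) = fconnect (face_next G) d d'.
Proof. by rewrite inE -fconnect_orbit. Qed.

Lemma face_of_eq d d' : (face_of d == face_of d') = fconnect (face_next G) d d'.
Proof.
apply/eqP/idP => [E|dd'].
  by rewrite -mem_face_of E mem_face_of connect0.
apply/setP => c; rewrite !mem_face_of.
by rewrite (same_connect (fconnect_sym face_next_inj) dd').
Qed.

Lemma face_of_next d : face_of (face_next G d) = face_of d.
Proof.
apply/eqP; rewrite face_of_eq fconnect_sym; last exact: face_next_inj.
exact: fconnect1.
Qed.

Lemma face_of_in_faces d : d \in darts G -> face_of d \in faces G.
Proof. by move=> dG; apply/imsetP; exists d. Qed.

Lemma face_of_sub d c : d \in darts G -> c \in face_of d -> c \in darts G.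
Proof.
move=> dG; rewrite mem_face_of => /iter_findex <-.
by elim: (findex _ _ _) => //= i IH; rewrite face_next_dart.
Qed.

Lemma facesP F : reflect (exists2 d, d \in darts G & F = face_of d) (F \in faces G).
Proof. exact: imsetP. Qed.

Lemma face_ofP F d : F \in faces G -> (d \in F) = (d \in darts G) && (face_of d == F).
Proof.
case/facesP => c cG ->; rewrite face_of_eq mem_face_of; apply/idP/andP => [cd|[_]].
  split; first by apply: (@face_of_sub c) => //; rewrite mem_face_of.
  by rewrite fconnect_sym //; exact: face_next_inj.
by rewrite fconnect_sym //; exact: face_next_inj.
Qed.

Lemma card_darts : #|darts G| = (2 * #|edges G|)%N.
Proof.
rewrite -sum1_card (partition_big_imset (fun d : 'I_n * 'I_n => [set d.1; d.2])) /=.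
rewrite -/(edges G) (eq_bigr (fun=> 2)) ?sum_nat_const 1?mulnC // => e /imsetP[[a b]].
rewrite inE /= => ab ->; rewrite sum1dep_card.
have -> : [set x | (x \in darts G) && ([set x.1; x.2] == [set a; b])] = [set (a, b); (b, a)].
  apply/setP => -[c d]; rewrite !inE !xpair_eqE /=; apply/andP/idP => [[cd /eqP/setP E]|].
    have cNd : c != d by apply: contraTneq cd => ->; rewrite adj_irr.
    have /orP dE : (d == a) || (d == b) by have := E d; rewrite !inE eqxx orbT => <-.
    have /orP cE : (c == a) || (c == b) by have := E c; rewrite !inE eqxx => <-.
    by move: cNd; case: dE => /eqP->; case: cE => /eqP->; rewrite ?eqxx ?orbT.
  by case/orP => /andP[/eqP-> /eqP->]; [|rewrite adj_sym finset.setUC].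
rewrite cards2 xpair_eqE negb_and; case: eqVneq => // E.
by move: ab; rewrite E adj_irr.
Qed.

End EmbeddedGraphs.

(** * The corners of a plane graph as a spherical incidence structure *)

Section PlaneIncidences.
Local Open Scope ring_scope.
Variables (n : nat) (G : embedded_graph n).
Hypothesis planeG : plane G.
Hypothesis uniq_faces : forall d, d \in darts G -> uniq (face_walk G d).

Lemma connected_ind (P : 'I_n -> Prop) x y :
  (forall a b, adj G a b -> P a -> P b) -> P x -> P y.
Proof.
move=> IH Px; have [conn _] := planeG.
have in0 z : z \notin (finset.set0 : {set 'I_n}) by rewrite inE.
have /connectP[p] := conn x y (in0 _) (in0 _).
elim: p x Px => [x Px _ -> //|z p IHp x Px /= /andP[/and3P[xz _ _] zp] yE].
by apply: IHp zp yE; exact: IH xz Px.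
Qed.

(** The dart [c] stands for the corner at its source, between the edge [c] and the edge to the
    preceding neighbour, by which the face walk arrives. A walk without repeated vertices has only
    one corner at each vertex. *)
Lemma corner_inj c c' : c \in darts G -> c.1 = c'.1 -> face_of G c = face_of G c' -> c = c'.
Proof.
move=> cG E1 /eqP; rewrite face_of_eq fconnect_orbit => c'O.
have cO : c \in orbit (face_next G) c by rewrite -fconnect_orbit connect0.
have U := uniq_faces cG; rewrite /face_walk in U.
rewrite -(nth_index c cO) -(nth_index c c'O); congr nth; apply/eqP.
rewrite -(nth_uniq c.1 _ _ U) ?size_map ?index_mem //.
by rewrite !(nth_map c) ?index_mem // !nth_index // E1.
Qed.

(** This sum and that of [sum_face] telescope: the second edge of a corner is the first edge of the
    previous corner, in the rotation about the vertex here and in face tracing there. *)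
Lemma sum_rot (a : {set 'I_n} -> rat) x :
  \sum_(c in darts G | c.1 == x) (a [set c.1; c.2] - a [set c.1; (Defs.rot G c.1)^-1%g c.2]) = 0.
Proof.
rewrite sumrB [X in _ - X](reindex_inj (h := fun c => (c.1, Defs.rot G c.1 c.2))) /=; last first.
  by move=> [c d] [c' d'] [/= -> /perm_inj->].
apply/eqP; rewrite subr_eq0; apply/eqP; apply: eq_big => [[c d]|[c d] _] /=.
  congr (_ && _); rewrite !inE /=; apply/idP/idP; first exact: adj_rot.
  by move/adj_rotV; rewrite permK.
by rewrite permK.
Qed.

Lemma sum_face (a : {set 'I_n} -> rat) F :
  \sum_(c in darts G | face_of G c == F) (a [set c.1; c.2] - a [set c.1; (Defs.rot G c.1)^-1%g c.2]) = 0.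
Proof.
rewrite sumrB [X in _ - X](reindex_inj (@face_next_inj _ G)) /=.
apply/eqP; rewrite subr_eq0; apply/eqP; apply: eq_big => [c|c _].
  by rewrite face_next_dart face_of_next.
by rewrite /= permK finset.setUC.
Qed.

(** Connectivity of the dual: turning around a vertex shows that all its edges agree, and adjacent
    vertices share an edge. *)
Lemma darts_edge_constant (a : {set 'I_n} -> rat) :
  (forall c, c \in darts G -> a [set c.1; c.2] = a [set c.1; (Defs.rot G c.1)^-1%g c.2]) ->
  forall c d, c \in darts G -> d \in darts G -> a [set c.1; c.2] = a [set d.1; d.2].
Proof.
move=> H [x b] [y b']; rewrite !inE /= => xb.
have around z c c' : adj G z c -> adj G z c' -> a [set z; c] = a [set z; c'].
  move=> zc zc'; apply: (rot_ind _ zc zc' (P := fun c' => a [set z; c] = a [set z; c'])) => // e ze ->.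
  by have := H (z, Defs.rot G z e); rewrite inE /= permK => /(_ (adj_rot ze)).
move: b'; apply: (connected_ind (P := fun y => forall b', adj G y b' -> a [set x; b] = a [set y; b']) (x := x)).
  move=> u v uv IH b' vb'; rewrite (IH _ uv) finset.setUC.
  by apply: around => //; rewrite adj_sym.
by move=> b' xb'; exact: around.
Qed.

Lemma incidences_bound (v0 : 'I_n) (S : {set 'I_n}) (T : {set {set 'I_n * 'I_n}}) :
  T \subset faces G -> (2 < #|S| + #|T|)%N ->
  (#|[set c in darts G | (c.1 \in S) && (face_of G c \in T)]| + 4 <= 2 * (#|S| + #|T|))%N.
Proof.
move=> TF ST.
pose D : finType := {c | c \in darts G}; pose F : finType := {f | f \in faces G}; pose E : finType := {e | e \in edges G}.
pose v (c : D) := (val c).1.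
have fP (c : D) : face_of G (val c) \in faces G by apply: face_of_in_faces; exact: valP.
have e1P (c : D) : [set (val c).1; (val c).2] \in edges G by apply/imsetP; exists (val c) => //; exact: valP.
have e2P (c : D) : [set (val c).1; (Defs.rot G (val c).1)^-1%g (val c).2] \in edges G.
  apply/imsetP; exists ((val c).1, (Defs.rot G (val c).1)^-1%g (val c).2) => //.
  by have := valP c; rewrite !inE /= => /adj_rotV.
pose mkE e (eE : e \in edges G) : E := Sub e eE.
pose mkD c (cG : c \in darts G) : D := Sub c cG.
pose f (c : D) : F := Sub (face_of G (val c)) (fP c).
pose e1 (c : D) : E := mkE _ (e1P c).
pose e2 (c : D) : E := mkE _ (e2P c).
(* [sum_rot] and [sum_face] take functions on all vertex sets, so functions on the subtype of edges
   are extended by 0. *)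
pose ext (a : E -> rat) (e : {set 'I_n}) : rat := if insub e is Some e' then a e' else 0.
have extE a (e : E) : ext a (val e) = a e by rewrite /ext valK.
pose W : {set 'I_n + F} := [set w | match w with inl x => x \in S | inr y => val y \in T end].
have WE : #|W| = (#|S| + #|T|)%N.
  rewrite -!sum1_card big_mkcond big_sumType /= -!big_mkcond /=.
  congr (_ + _)%N; first by apply: eq_bigl => x; rewrite inE.
  rewrite [RHS](eq_bigl (fun f => (f \in faces G) && (f \in T))); last first.
    by move=> y; case: (boolP (y \in T)) => [/(fintype.subsetP TF)->|]; rewrite ?andbF.
  by rewrite [RHS]big_sub_cond; apply: eq_bigl => x; rewrite inE.
have CE : #|[set c | (inl (v c) \in W) && (inr (f c) \in W)]| =
    #|[set c in darts G | (c.1 \in S) && (face_of G c \in T)]|.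
  rewrite -!sum1dep_card [RHS]big_sub_cond; apply: eq_bigl => c.
  by rewrite !inE.
rewrite -CE -WE; apply: (@planar_bipartite_edges _ _ _ _ v f e1 e2 v0); last by rewrite WE.
- move=> c c' vE fE; apply: val_inj; apply: corner_inj => //; first exact: valP.
  exact: (congr1 val fE).
- move=> a x; rewrite -[RHS](sum_rot (ext a) x) [RHS]big_sub_cond; apply: eq_bigr => c _.
  by rewrite -(extE _ (e1 c)) -(extE _ (e2 c)).
- move=> a y; rewrite -[RHS](sum_face (ext a) (val y)) [RHS]big_sub_cond; apply: eq_bigr => c _.
  by rewrite -(extE _ (e1 c)) -(extE _ (e2 c)).
- move=> p q pq p0; have p_adj a b : adj G a b -> p a = 0 -> p b = 0.
    move=> ab pa; have abG : (a, b) \in darts G by rewrite inE.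
    have baG : face_next G (a, b) \in darts G by rewrite face_next_dart.
    have := pq (mkD _ abG); rewrite /v /= pa add0r => qf.
    have := pq (mkD _ baG); rewrite /v /=.
    suff -> : f (mkD _ baG) = f (mkD _ abG) by rewrite qf addr0.
    by apply: val_inj; rewrite /= face_of_next.
  have pE x : p x = 0 by have /= := @connected_ind (fun x => p x = 0) v0 x p_adj p0.
  split=> // -[y yF]; have /facesP[d dG yE] := yF.
  have := pq (mkD d dG); rewrite pE add0r => <-; congr q.
  by apply: val_inj.
- move=> a aE [e eE] [e' e'E]; have /imsetP[d dG dE] := eE; have /imsetP[d' d'G d'E] := e'E.
  rewrite -(extE a (mkE e eE)) -(extE a (mkE e' e'E)) /= dE d'E.
  apply: darts_edge_constant => // c cG; have := aE (mkD c cG).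
  by rewrite -(extE a (e1 _)) -(extE a (e2 _)).
(* There are twice as many darts as edges, which turns V + F = E + 2 into |D| + 2 = V + F + E. *)
- have [_ euler] := planeG.
  rewrite !card_sig card_ord.
  have cardE (T' : finType) (A : {set T'}) : #|[pred x in A]| = #|A| by exact: eq_card.
  by rewrite !cardE card_darts; lia.
Qed.

Definition face_vertices (F : {set 'I_n * 'I_n}) : {set 'I_n} := [set d.1 | d in F].

Lemma card_face_vertices F (S : {set 'I_n}) : F \in faces G ->
  #|face_vertices F :&: S| = #|[set c in F | c.1 \in S]|.
Proof.
move=> FG; rewrite -(card_in_imset (f := fst)); last first.
  move=> c c'; rewrite !inE !(face_ofP _ FG) => /andP[/andP[cG /eqP cF] _].
  move=> /andP[/andP[c'G /eqP c'F] _] E; apply: corner_inj => //.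
  by rewrite cF.
apply: eq_card => x; rewrite inE; apply/andP/imsetP => [[/imsetP[c cF ->] cS]|[c]].
  by exists c; rewrite // inE cF.
by rewrite inE => /andP[cF cS] ->; split=> //; apply/imsetP; exists c.
Qed.

(** Apply the edge bound to [S] and the set [T] of faces with more than two vertices in [S]. The
    incidences number the excess plus 2|T|, and 2|T| cancels. *)
Lemma face_excess (S : {set 'I_n}) : (1 < #|S|)%N ->
  (\sum_(F in faces G) (#|face_vertices F :&: S| - 2) <= 2 * (#|S| - 2))%N.
Proof.
move=> S2; pose T := [set F in faces G | (2 < #|face_vertices F :&: S|)%N].
have TE : (\sum_(F in faces G) (#|face_vertices F :&: S| - 2) =
    \sum_(F in T) (#|face_vertices F :&: S| - 2))%N.
  rewrite [RHS](eq_bigl (fun F => (F \in faces G) && (2 < #|face_vertices F :&: S|)%N)); last first.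
    by move=> F; rewrite inE.
  rewrite big_mkcondr /=; apply: eq_bigr => F _.
  by case: ltnP => // ?; apply/eqP; rewrite subn_eq0.
have [T0|T0] := posnP #|T|.
  by rewrite TE (cards0_eq T0) big_set0.
have /card_gt0P[v0 _] : (0 < #|S|)%N by lia.
have TF : T \subset faces G by apply/fintype.subsetP => F; rewrite inE => /andP[].
have := incidences_bound v0 TF (S := S); rewrite (_ : (2 < _)%N); last by lia.
move=> /(_ isT).
suff -> : #|[set c in darts G | (c.1 \in S) && (face_of G c \in T)]| =
    (\sum_(F in T) (#|face_vertices F :&: S| - 2) + 2 * #|T|)%N by rewrite TE; lia.
rewrite mulnC -sum_nat_const -big_split /= -sum1_card.
rewrite (partition_big (face_of G) (mem T)) /=; last by move=> c; rewrite inE => /and3P[].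
apply: eq_bigr => F; rewrite inE => /andP[FG F2]; rewrite subnK; last exact: ltnW.
rewrite card_face_vertices // sum1dep_card; apply: eq_card => c; rewrite !inE.
rewrite (face_ofP _ FG) !inE -!andbA; congr (_ && _).
by case: eqP => [->|_]; rewrite ?andbF // FG F2 !andbT.
Qed.

End PlaneIncidences.

Lemma card_darts_faces n k (G : embedded_graph n) :
  (forall d, d \in darts G -> size (face_walk G d) = k) ->
  #|darts G| = (k * #|faces G|)%N.
Proof.
move=> size_k; rewrite -sum1_card (partition_big (face_of G) (mem (faces G))) /=; last exact: face_of_in_faces.
rewrite mulnC -sum_nat_const; apply: eq_bigr => F /facesP[d dG ->].
rewrite -(size_k d dG) size_map -(card_uniqP (orbit_uniq _ _)) sum1dep_card; apply: eq_card => c.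
rewrite inE -fconnect_orbit eq_sym face_of_eq; apply: andb_idl => dc.
by apply: (@face_of_sub _ _ d) => //; rewrite mem_face_of.
Qed.

(** * Counting in closed k-angulations *)

Section ClosedAngulations.
Variables (n k : nat) (G : embedded_graph n).
Hypothesis Gk : closed_angulation G k.

Lemma angulation_plane : plane G. Proof. by case: Gk. Qed.

Lemma angulation_walk_uniq d : d \in darts G -> uniq (face_walk G d).
Proof. by case: Gk => _ _ H /H[/andP[]]. Qed.

Lemma angulation_walk_size d : d \in darts G -> size (face_walk G d) = k.
Proof. by case: Gk => _ _ H /H[]. Qed.

Lemma card_face F : F \in faces G -> #|F| = k.
Proof.
case/facesP => d dG ->; rewrite -(angulation_walk_size dG) size_map /face_of cardsE.
by apply/card_uniqP; exact: orbit_uniq.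
Qed.

Lemma angulation_card_faces : (2 < k)%N -> (#|faces G| * (k - 2) = 2 * (n - 2))%N.
Proof.
move=> k3; have [[_ euler] [n2 _] _] := Gk.
have := card_darts_faces angulation_walk_size; have := card_darts G; move=> -> E.
have -> : k = (k - 2 + 2)%N by lia.
rewrite addnK; move: E; have -> : (k * #|faces G| = (k - 2) * #|faces G| + 2 * #|faces G|)%N by nia.
by lia.
Qed.

Lemma face_hypergraphE : face_hypergraph G = [set face_vertices F | F in faces G].
Proof.
have E d : [set v in face_walk G d] = face_vertices (face_of G d).
  by apply/setP => x; rewrite inE; apply/mapP/imsetP => -[c cO ->]; exists c; rewrite // ?inE // in cO *.
apply/setP => e; apply/imsetP/imsetP => [[d dG ->]|[F /facesP[d dG ->] ->]].
  by exists (face_of G d); rewrite ?face_of_in_faces.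
by exists d.
Qed.

Lemma card_face_hyperedge e : e \in face_hypergraph G -> #|e| = k.
Proof.
rewrite face_hypergraphE => /imsetP[F FG ->].
rewrite -[face_vertices F]finset.setIT (card_face_vertices angulation_walk_uniq) //.
by rewrite -(card_face FG); apply: eq_card => c; rewrite !inE andbT.
Qed.

(** Several faces could have the same vertex set and give a single hyperedge; keeping one face from
    each class only lowers the sum. *)
Lemma face_hypergraph_excess (S : {set 'I_n}) : (1 < #|S|)%N ->
  (\sum_(e in face_hypergraph G) (#|e :&: S| - 2) <= 2 * (#|S| - 2))%N.
Proof.
move=> S2; apply: leq_trans (face_excess angulation_plane angulation_walk_uniq S2).
rewrite face_hypergraphE [X in (_ <= X)%N](partition_big_imset (@face_vertices n)) /=.
apply: leq_sum => e /imsetP[F FG ->].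
by rewrite (bigD1 F) ?FG ?eqxx //= leq_addr.
Qed.

Lemma angulation_neighbour v : exists w, adj G v w.
Proof.
have [[conn _] [n2 _] _] := Gk.
have /card_gt0P[x xv] : (0 < #|[set~ v]|)%N by rewrite cardsC1 card_ord; lia.
rewrite !inE in xv.
have in0 z : z \notin (finset.set0 : {set 'I_n}) by rewrite inE.
have /connectP[[_ E|w p /= /andP[/andP[vw _] _] _]] := conn v x (in0 _) (in0 _).
  by rewrite E eqxx in xv.
by exists w.
Qed.

Lemma face_hypergraph_cover v : exists2 e, e \in face_hypergraph G & v \in e.
Proof.
have [w vw] := angulation_neighbour v.
have dG : (v, w) \in darts G by rewrite inE.
exists [set x in face_walk G (v, w)]; first by apply/imsetP; exists (v, w).
rewrite inE; apply/mapP; exists (v, w) => //; rewrite -fconnect_orbit connect0 //.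
Qed.

End ClosedAngulations.

(** * The sharp bound on the spectral radius *)

Section TopTwo.
Local Open Scope ring_scope.
Variables (R : realFieldType) (T : finType) (H : {set {set T}}) (y : T -> R).
Hypothesis excess : forall S : {set T}, (1 < #|S|)%N ->
  (\sum_(e in H) (#|e :&: S| - 2) <= 2 * (#|S| - 2))%N.

Let dec : rel T := [rel a b | y b <= y a].

Lemma sum_drop2_rcons (s : seq T) v :
  \sum_(a <- drop 2 (rcons s v)) y a = \sum_(a <- drop 2 s) y a + (1 < size s)%N%:R * y v.
Proof.
case: ltnP => s2; first by rewrite drop_rcons // big_rcons /= mul1r.
by rewrite !drop_oversize ?size_rcons ?big_nil ?mul0r ?addr0 // (leq_trans s2).
Qed.

Lemma size_drop2_rcons (s : seq T) v :
  (size (rcons s v) - 2)%N%:R = (size s - 2)%N%:R + (1 < size s)%N%:R :> R.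
Proof. by rewrite -natrD; congr _%:R; rewrite size_rcons; lia. Qed.

Lemma excess_seq (s : seq T) : uniq s ->
  (\sum_(e in H) (size [seq a <- s | a \in e] - 2) <= 2 * (size s - 2))%N.
Proof.
move=> Us; have [s2|s2] := ltnP 1 (size s); last first.
  rewrite big1 ?leq0n // => e _; apply/eqP; rewrite subn_eq0 size_filter.
  by apply: leq_trans (count_size _ _) _; lia.
have := excess (S := [set a in s]); rewrite cardsE (card_uniqP Us) => /(_ s2).
apply: leq_trans; apply: leq_sum => e _; rewrite leq_sub2r //.
rewrite -(card_uniqP (filter_uniq _ Us)); apply: subset_leq_card; apply/fintype.subsetP => a.
by rewrite mem_filter !inE.
Qed.

(* Abel summation: [y] is a nonnegative combination of indicators of initial
   segments of [s], and for an initial segment this is the bound [excess]. *)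
Lemma excess_abel (s : seq T) (c : R) : uniq s -> sorted dec s -> 0 <= c ->
  (forall v, v \in s -> c <= y v) ->
  c * (2 * (size s - 2)%N%:R - \sum_(e in H) (size [seq a <- s | a \in e] - 2)%N%:R) <=
  2 * (\sum_(v <- drop 2 s) y v) - \sum_(e in H) \sum_(v <- drop 2 [seq a <- s | a \in e]) y v.
Proof.
elim/last_ind: s c => [|s v IHs] c.
  move=> _ _ c0 _; rewrite /= sub0n mulr0 !big_nil mulr0.
  by rewrite !big1 ?subrr ?mulr0 // => e _; rewrite big_nil.
move=> Usv; have := excess_seq Usv; move: Usv; rewrite rcons_uniq => /andP[vs Us] NV.
move=> sv c0 cy.
have ss : sorted dec s by apply: subseq_sorted (subseq_rcons _ _) sv => b a d; rewrite /dec /= => ab bd; exact: le_trans bd ab.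
have yv a : a \in s -> y v <= y a.
  move=> a_s; have tr : transitive dec by move=> b a' d; rewrite /dec /= => ab bd; exact: le_trans bd ab.
  move: sv; rewrite -cats1 => sv; have := order_path_min.
  by move: sv; rewrite sorted_pairwise // pairwise_cat /= allrel1r => /andP[/allP/(_ a a_s)].
have yv0 : 0 <= y v by apply: le_trans c0 (cy v _); rewrite mem_rcons mem_head.
(* The induction hypothesis is taken at the last, smallest value [y v]. Appending [v] changes both
   sides by [y v * d], and [excess_seq] makes the bracket nonnegative, so that [y v] may be lowered
   to [c]. *)
have IH := IHs (y v) Us ss yv0 yv.
pose dn (e : {set T}) : R := if v \in e then (1 < size [seq a <- s | a \in e])%N%:R else 0.
pose d : R := 2 * (1 < size s)%N%:R - \sum_(e in H) dn e.
have NE : 2 * (size (rcons s v) - 2)%N%:R - \sum_(e in H) (size [seq a <- rcons s v | a \in e] - 2)%N%:R =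
   2 * (size s - 2)%N%:R - \sum_(e in H) (size [seq a <- s | a \in e] - 2)%N%:R + d :> R.
  rewrite (eq_bigr (fun e : {set T} => (size [seq a <- s | a \in e] - 2)%N%:R + dn e)).
    by rewrite big_split /= size_drop2_rcons /d; ring.
  move=> e _; rewrite filter_rcons /dn; case: (v \in e); last by rewrite addr0.
  exact: size_drop2_rcons.
have DE : 2 * (\sum_(v <- drop 2 (rcons s v)) y v) - \sum_(e in H) \sum_(v <- drop 2 [seq a <- rcons s v | a \in e]) y v =
   2 * (\sum_(v <- drop 2 s) y v) - \sum_(e in H) \sum_(v <- drop 2 [seq a <- s | a \in e]) y v + d * y v.
  rewrite (eq_bigr (fun e : {set T} => \sum_(v <- drop 2 [seq a <- s | a \in e]) y v + dn e * y v)).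
    by rewrite big_split /= -mulr_suml sum_drop2_rcons /d; ring.
  move=> e _; rewrite filter_rcons /dn; case: (v \in e); last by rewrite mul0r addr0.
  exact: sum_drop2_rcons.
rewrite DE; apply: (@le_trans _ _ (y v * (2 * (size (rcons s v) - 2)%N%:R - \sum_(e in H) (size [seq a <- rcons s v | a \in e] - 2)%N%:R))).
  apply: ler_wpM2r; last by apply: cy; rewrite mem_rcons mem_head.
  by rewrite subr_ge0 -natr_sum -natrM ler_nat.
by rewrite NE mulrDr [d * _]mulrC lerD2r.
Qed.

Lemma excess_sum (s : seq T) : uniq s -> sorted dec s -> (forall v, 0 <= y v) ->
  \sum_(e in H) \sum_(v <- drop 2 [seq a <- s | a \in e]) y v <= 2 * \sum_(v <- drop 2 s) y v.
Proof.
move=> Us ss y0; rewrite -subr_ge0; apply: le_trans (excess_abel Us ss (lexx 0) _) => //.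
by rewrite mul0r.
Qed.

End TopTwo.

(** * AM-GM on one hyperedge *)

Section AMGM.
Local Open Scope ring_scope.
Variables (R : realFieldType) (T : finType) (k t : nat) (s z : R).
Hypotheses (k2 : (2 < k)%N) (t0 : (0 < t)%N) (s0 : 0 < s) (z0 : 0 < z).
Hypotheses (sk : s ^+ k * k%:R = 1) (zk : z ^+ k * (k%:R * t%:R / 2) = 1).
Variables (e A : {set T}) (x : T -> R).
Hypotheses (ek : #|e| = k) (Ae : A \subset e) (A2 : #|A| = 2) (x0 : forall v, 0 <= x v).

(** [w] is the inverse of the extremal weight, with [A] in the role of the hubs, so that [E] is
    constantly 1 at the extremal vector; [mu] is the mean of [E] over [e]. *)
Let w v : R := if v \in A then k%:R else k%:R * t%:R / 2.
Let mu := (\sum_(v in A) x v ^+ k) + t%:R / 2 * \sum_(v in e :\: A) x v ^+ k.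
Let E v := x v ^+ k * w v.

(** This is AM-GM for [E]: the product of the [w v] is inverse to the k-th power of
    [s ^+ 2 * z ^+ (k - 2)]. Comparing k-th powers avoids roots. *)
Lemma edge_AGM : \prod_(v in e) x v <= s ^+ 2 * z ^+ (k - 2) * mu ?=
  iff [forall u in e, forall v in e, E u == E v].
Proof.
have kR : 0 < k%:R :> R by rewrite ltr0n; exact: leq_trans k2.
have tR : 0 < t%:R :> R by rewrite ltr0n.
have w0 v : 0 <= w v by rewrite /w; case: ifP => _; [exact: ltW | rewrite !mulr_ge0 // ltW].
have E0 v : 0 <= E v by rewrite mulr_ge0 // exprn_ge0.
have split_sum (g : T -> R) : \sum_(v in e) g v = \sum_(v in A) g v + \sum_(v in e :\: A) g v.
  by rewrite (big_setID A) /= (finset.setIidPr Ae).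
have split_prod (g : T -> R) : \prod_(v in e) g v = \prod_(v in A) g v * \prod_(v in e :\: A) g v.
  by rewrite (big_setID A) /= (finset.setIidPr Ae).
have eDA : #|e :\: A| = (k - 2)%N by rewrite cardsD (finset.setIidPr Ae) ek A2.
have muE : (\sum_(v in e) E v) / #|e|%:R = mu.
  rewrite split_sum ek /mu mulrDl; congr (_ + _).
    rewrite (eq_bigr (fun v => x v ^+ k * k%:R)) => [|v vA]; last by rewrite /E /w vA.
    by rewrite -mulr_suml mulfK // gt_eqF.
  rewrite (eq_bigr (fun v => x v ^+ k * (k%:R * t%:R / 2))) => [|v]; last first.
    by rewrite inE /E /w => /andP[/negPf->].
  rewrite -mulr_suml mulrC -!mulrA mulrA; field; exact: lt0r_neq0.
have prodE : \prod_(v in e) E v * (s ^+ 2 * z ^+ (k - 2)) ^+ k = (\prod_(v in e) x v) ^+ k.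
  rewrite /E big_split /= -prodrXl -mulrA -[RHS]mulr1; congr (_ * _).
  rewrite split_prod (eq_bigr (fun=> k%:R)) => [|v vA]; last by rewrite /w vA.
  rewrite [X in _ * X * _](eq_bigr (fun=> k%:R * t%:R / 2)) => [|v]; last first.
    by rewrite inE /w => /andP[/negPf->].
  rewrite !prodr_const A2 eDA [(s ^+ 2 * _) ^+ k]exprMn [(s ^+ 2) ^+ k]exprAC [(z ^+ _) ^+ k]exprAC.
  by rewrite mulrACA -[k%:R ^+ 2 * _]exprMn -[(_ / 2) ^+ _ * _]exprMn [k%:R * _]mulrC sk [_ * (z ^+ k)]mulrC zk !expr1n mulr1.
have Q0 : 0 < s ^+ 2 * z ^+ (k - 2) by rewrite mulr_gt0 // exprn_gt0.
have [le1 eq1] := leif_AGM (A := mem e) (E := E) (fun v _ => E0 v).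
have muE' : \sum_(v in e) E v / #|e|%:R = mu by rewrite -mulr_suml.
rewrite /= muE ek in le1 eq1.
have mu0 : 0 <= mu by rewrite -muE divr_ge0 // sumr_ge0.
have P0 : 0 <= \prod_(v in e) x v by rewrite prodr_ge0.
have kn0 : (0 < k)%N by exact: leq_trans k2.
move: (s ^+ 2 * z ^+ (k - 2)) Q0 prodE => Q Q0 prodE; have Q0' := ltW Q0.
split.
  rewrite -(ler_pXn2r kn0) ?nnegrE ?mulr_ge0 //.
  by rewrite -prodE exprMn mulrC ler_pM2l // exprn_gt0.
rewrite -eq1 -(eqrXn2 kn0) ?mulr_ge0 // -prodE exprMn [Q ^+ k * _]mulrC.
apply/eqP/eqP => [|-> //].
by apply: mulIf; rewrite expf_neq0 // gt_eqF.
Qed.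

End AMGM.

Section BigSums.
Local Open Scope ring_scope.

Lemma eq_sum_le (R : numDomainType) (I : finType) (P : pred I) (f g : I -> R) :
  (forall i, P i -> f i <= g i) -> \sum_(i | P i) g i <= \sum_(i | P i) f i ->
  forall i, P i -> f i = g i.
Proof.
move=> fg gf i Pi; apply/eqP; rewrite eq_sym -subr_eq0; apply/eqP.
apply: (psumr_eq0P (F := fun i => g i - f i) _ _ Pi) => [j Pj|].
  by rewrite subr_ge0 fg.
by apply/eqP; rewrite sumrB subr_eq0 eq_le gf ler_sum.
Qed.

Lemma sum_set_seq (R : nmodType) (I : finType) (r : seq I) (F : I -> R) : uniq r ->
  \sum_(i in [set j in r]) F i = \sum_(i <- r) F i.
Proof. by move=> Ur; rewrite big_uniq //; apply: eq_bigl => i; rewrite inE. Qed.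

End BigSums.

(** * Summation over the hyperedges and the case of equality *)

Section ExtremalBound.
Local Open Scope ring_scope.
Variables (R : realType) (k n t : nat) (s z : R) (H : hypergraph n).
Hypotheses (k2 : (2 < k)%N) (t2 : (2 < t)%N) (s0 : 0 < s) (z0 : 0 < z).
Hypotheses (sk : s ^+ k * k%:R = 1) (zk : z ^+ k * (k%:R * t%:R / 2) = 1).
Hypothesis tn : (t * (k - 2) = 2 * (n - 2))%N.
Hypothesis n2 : (1 < n)%N.
Hypothesis Hk : forall e, e \in H -> #|e| = k.
Hypothesis Ht : (#|H| <= t)%N.
Hypothesis Hcover : forall v, exists2 e, e \in H & v \in e.
Hypothesis excess : forall S : {set 'I_n}, (1 < #|S|)%N ->
  (\sum_(e in H) (#|e :&: S| - 2) <= 2 * (#|S| - 2))%N.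
Variable x : 'rV[R]_n.
Hypothesis xU : unit_nonneg k x.

Let y v := x ord0 v ^+ k.
Let dec : rel 'I_n := [rel a b | y b <= y a].
Let srt := sort dec (enum 'I_n).
Let Q := s ^+ 2 * z ^+ (k - 2).

Lemma extremal_bound : hyper_form k H x <= k%:R * Q * t%:R /\
  (hyper_form k H x = k%:R * Q * t%:R ->
   exists u w, u != w /\ forall e, e \in H -> (u \in e) && (w \in e)).
Proof.
case: xU => x0 y1; have y0 v : 0 <= y v by exact: exprn_ge0.
have kR : 0 < k%:R :> R by rewrite ltr0n; exact: leq_trans k2.
have tR : 2 < t%:R :> R by rewrite ltr_nat.
have tgt0 : 0 < t%:R :> R by lra.
have Q0 : 0 < Q by rewrite mulr_gt0 // exprn_gt0.
have Usrt : uniq srt by rewrite sort_uniq enum_uniq.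
have ssrt : sorted dec srt by apply: sort_sorted => a b; exact: le_total.
have insrt v : v \in srt by rewrite mem_sort mem_enum.
have sz : size srt = n by rewrite size_sort size_enum_ord.
have dec_tr : transitive dec by move=> b a c ab bc; exact: le_trans bc ab.
case srtE : srt => [|u [|w tl]]; [by have : (1 < size srt)%N; [rewrite sz | rewrite srtE]..|].
have szt : size tl = (n - 2)%N by have := sz; rewrite srtE /=; lia.
have uw : u != w by have := Usrt; rewrite srtE /= inE negb_or -andbA => /andP[].
have yu v : y v <= y u.
  have := insrt v; rewrite srtE inE => /predU1P[->//|vtl].
  have : path dec u (w :: tl) by have := ssrt; rewrite srtE.
  by move=> /(order_path_min dec_tr)/allP/(_ v vtl).
have yw v : v != u -> y v <= y w.
  have := insrt v; rewrite srtE !inE => /or3P[/eqP->|/eqP->|vtl] // vu; first by rewrite eqxx in vu.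
  have := ssrt; rewrite srtE /= => /andP[_].
  by move=> /(order_path_min dec_tr)/allP/(_ v vtl).
pose M := y u + y w; pose L := \sum_(v <- tl) y v.
have ML : M + L = 1.
  have : \sum_(v <- srt) y v = \sum_v y v.
    by rewrite (perm_big (enum 'I_n)) ?big_enum // perm_sort.
  by rewrite srtE !big_cons addrA {3}/y y1.
pose l (e : {set 'I_n}) := [seq a <- srt | a \in e].
pose A e := [set a in take 2 (l e)].
have Ul e : uniq (l e) by exact: filter_uniq.
have lE e : l e =i e by move=> a; rewrite mem_filter insrt andbT.
have szl e : e \in H -> size (l e) = k.
  by move=> /Hk <-; rewrite -(card_uniqP (Ul e)); apply: eq_card; exact: lE.
have AsubE e : A e \subset e.
  by apply/fintype.subsetP => a; rewrite inE => /mem_take; rewrite lE.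
have A2 e : e \in H -> #|A e| = 2.
  move=> eH; rewrite cardsE (card_uniqP (take_uniq _ (Ul e))) size_take szl //.
  by rewrite k2.
have eA e : e :\: A e = [set a in drop 2 (l e)].
  apply/setP => a; rewrite !inE -(lE e).
  have := Ul e; rewrite -{1 3}[l e](cat_take_drop 2) cat_uniq mem_cat => /and3P[_ /hasPn td _].
  by case: (boolP (a \in drop 2 _)) => [/td->|_]; rewrite ?orbT ?orbF ?andNb.
have hubM e : e \in H -> \sum_(v in A e) y v <= M.
  move=> /A2/eqP/cards2P[a [b [ab ->]]]; rewrite big_setU1 ?inE //= big_set1.
  have [au|au] := eqVneq a u; first by rewrite lerD // yw // -au eq_sym.
  by rewrite addrC lerD // yw.
have restL : \sum_(e in H) \sum_(v in e :\: A e) y v <= 2 * L.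
  have -> : L = \sum_(v <- drop 2 srt) y v by rewrite srtE /= drop0.
  apply: le_trans (excess_sum excess Usrt ssrt y0).
  by apply: ler_sum => e _; rewrite eA sum_set_seq ?drop_uniq.
pose mu e := \sum_(v in A e) y v + t%:R / 2 * \sum_(v in e :\: A e) y v.
have AG e (eH : e \in H) := edge_AGM k2 (ltnW (ltnW t2)) s0 z0 sk zk (Hk eH) (AsubE e) (A2 e eH) (x := x ord0) x0.
have M0 : 0 <= M by rewrite addr_ge0.
have hubT : \sum_(e in H) \sum_(v in A e) y v <= #|H|%:R * M.
  by rewrite mulr_natl -sumr_const; apply: ler_sum.
have HtR : #|H|%:R * M <= t%:R * M by rewrite ler_wpM2r // ler_nat.
have sumP : \sum_(e in H) \prod_(v in e) x ord0 v <= Q * \sum_(e in H) mu e.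
  by rewrite mulr_sumr; apply: ler_sum => e /AG[].
have sum_mu : \sum_(e in H) mu e =
    \sum_(e in H) \sum_(v in A e) y v + t%:R / 2 * \sum_(e in H) \sum_(v in e :\: A e) y v.
  by rewrite big_split /= mulr_sumr.
have restT : t%:R / 2 * (\sum_(e in H) \sum_(v in e :\: A e) y v) <= t%:R * L.
  have -> : t%:R * L = t%:R / 2 * (2 * L) by field.
  by rewrite ler_pM2l //; lra.
have tML : t%:R * M + t%:R * L = t%:R :> R by rewrite -mulrDr ML mulr1.
(* The hubs contribute at most [t * M], the other vertices at most [t / 2] times [2 * L], and
   [M + L = 1]. *)
have mu_t : \sum_(e in H) mu e <= t%:R by rewrite sum_mu; lra.
have bound : \sum_(e in H) \prod_(v in e) x ord0 v <= Q * t%:R.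
  by apply: le_trans sumP _; rewrite ler_pM2l.
rewrite /hyper_form -mulrA ler_pM2l //; split=> // /(mulfI (lt0r_neq0 kR)) PE.
(* From here on equality is assumed, so every estimate above is tight, and the values of [y] can be
   read off. *)
have mu_t' : \sum_(e in H) mu e = t%:R.
  by apply/eqP; rewrite eq_le mu_t -(ler_pM2l Q0) -PE.
have AGeq e : e \in H -> forall a b, a \in e -> b \in e ->
    y a * (if a \in A e then k%:R else k%:R * t%:R / 2) =
    y b * (if b \in A e then k%:R else k%:R * t%:R / 2).
  move=> eH a b ae be; have [_ eqAG] := AG e eH.
  have : \prod_(v in e) x ord0 v = Q * mu e.
    apply: (eq_sum_le (P := mem H) (f := fun e : {set 'I_n} => \prod_(v in e) x ord0 v) (g := fun e => Q * mu e)) => //.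
      by move=> e' /AG[].
    by rewrite -mulr_sumr mu_t' PE.
  by move/eqP; rewrite eqAG => /forall_inP/(_ a ae)/forall_inP/(_ b be)/eqP.
have M1 : 0 < M.
  rewrite lt_neqAle M0 andbT; apply/negP => /eqP ME.
  have yu0 : y u = 0 by have := y0 u; have := y0 w; rewrite /M in ME; lra.
  have : \sum_v y v = 0.
    by apply: big1 => v _; apply/eqP; rewrite eq_le y0 andbT -yu0.
  by rewrite /y y1 => /eqP; rewrite oner_eq0.
have cardH : #|H|%:R = t%:R :> R.
  apply: (mulIf (lt0r_neq0 M1)); apply/eqP; rewrite eq_le HtR /=.
  by rewrite sum_mu in mu_t'; lra.
have hubE e : e \in H -> \sum_(v in A e) y v = M.
  apply: (eq_sum_le (P := mem H) (f := fun e => \sum_(v in A e) y v) (g := fun=> M)) => //.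
  by rewrite sumr_const -mulr_natl; rewrite sum_mu in mu_t'; lra.
have hub e a : e \in H -> a \in A e -> y a = M / 2.
  move=> eH aA; have := hubE e eH; rewrite (eq_bigr (fun=> y a)) => [|b bA].
    by rewrite sumr_const A2 // mulr2n => <-; field.
  have := AGeq e eH a b (fintype.subsetP (AsubE e) a aA) (fintype.subsetP (AsubE e) b bA).
  by rewrite aA bA => /(mulIf (lt0r_neq0 kR)).
have rest e v : e \in H -> v \in e -> v \notin A e -> y v = M / t%:R.
  move=> eH ve vA; have /card_gt0P[a aA] : (0 < #|A e|)%N by rewrite A2.
  have := AGeq e eH a v (fintype.subsetP (AsubE e) a aA) ve.
  rewrite aA (negPf vA) (hub e a) // => E.
  have : k%:R * M = k%:R * (y v * t%:R) by lra.
  by move/(mulfI (lt0r_neq0 kR)) => ->; rewrite mulfK // lt0r_neq0.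
(* Since t > 2, the value at hubs exceeds the value elsewhere; this separates the poles from the
   other vertices. *)
have Mt : M / t%:R < M / 2.
  by rewrite ltr_pM2l // ltf_pV2 // posrE.
have ylow v : M / t%:R <= y v.
  have [e eH ve] := Hcover v; have [vA|vA] := boolP (v \in A e).
    by rewrite (hub e v) // ltW.
  by rewrite (rest e v).
(* Together with the lower bound [ylow], this total forces the value [M / t] on all of [tl], so that
   no vertex of [tl] is a hub of any edge. *)
have LE : L = (n - 2)%N%:R * (M / t%:R).
  have : \sum_(e in H) \sum_(v in e :\: A e) y v = 2 * L.
    have : t%:R / 2 * (\sum_(e in H) \sum_(v in e :\: A e) y v) = t%:R * L.
      by rewrite sum_mu in mu_t'; lra.
    have -> : t%:R * L = t%:R / 2 * (2 * L) by field.
    by apply: mulfI; rewrite lt0r_neq0 //; lra.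
  rewrite (eq_bigr (fun=> (k - 2)%N%:R * (M / t%:R))) => [|e eH]; last first.
    rewrite (eq_bigr (fun=> M / t%:R)) => [|v].
      by rewrite sumr_const cardsD (finset.setIidPr (AsubE e)) Hk // A2 // mulr_natl.
    by rewrite inE => /andP[vA ve]; exact: rest vA.
  rewrite sumr_const -[X in X = _]mulr_natl cardH mulrA -natrM tn natrM => E.
  by apply: (@mulfI R 2); rewrite ?pnatr_eq0 // -E -mulrA.
have tlE v : v \in tl -> y v = M / t%:R.
  move=> vtl; have Utl : uniq tl by have := Usrt; rewrite srtE /= => /and3P[].
  have := @eq_sum_le R _ (mem tl) (fun=> M / t%:R) y (fun v _ => ylow v).
  rewrite -big_uniq // -/L LE sumr_const (card_uniqP Utl) szt mulr_natl lexx.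
  by move=> /(_ isT v vtl).
exists u, w; split=> // e eH.
suff AE : A e = [set u; w].
  by rewrite !(fintype.subsetP (AsubE e)) // AE !inE eqxx ?orbT.
apply/eqP; rewrite eqEcard A2 // cards2 uw andbT; apply/fintype.subsetP => a aA.
have := insrt a; rewrite srtE !inE => /or3P[->|->|/tlE] //; first by rewrite orbT.
by rewrite (hub e a) // => E; rewrite E ltxx in Mt.
Qed.

End ExtremalBound.

(** * Angulations with two vertices on all faces *)

Definition theta_edge n (t : nat) (c : 'I_n -> nat) (i : nat) : {set 'I_n} :=
  [set v | [|| (t <= c v)%N, c v == i | c v == (i.+1 %% t)%N]].

(* [c] maps the inner vertices of the i-th path to i < t and the two poles to t
   and t.+1; the paths have alternately a and k - a edges. *)
Definition theta_hypergraph n (k t a : nat) (H : hypergraph n) : Prop :=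
  exists c : 'I_n -> nat,
    [/\ forall v, (c v < t.+2)%N,
        forall i, (i < t.+2)%N -> #|[set v | c v == i]| =
          if (i < t)%N then (if odd i then k - a else a).-1 else 1%N &
        H = [set theta_edge t c i | i : 'I_t]].

Lemma modn_succ t i : (i < t)%N -> (i.+1 %% t = if i.+1 == t then 0 else i.+1)%N.
Proof. by case: eqP => [->|/eqP it ?]; rewrite ?modnn // modn_small //; lia. Qed.

Lemma modn_succ_neq t i : (1 < t)%N -> (i < t)%N -> i <> i.+1 %% t.
Proof. by move=> t1 it; rewrite modn_succ //; case: ifP; lia. Qed.

Lemma modn_succ_neq2 t i j : (2 < t)%N -> (i < t)%N -> j = i.+1 %% t -> i <> j.+1 %% t.
Proof. by move=> t2 it ->; rewrite (modn_succ it); case: ifP => it1; rewrite modn_succ; try case: ifP; lia. Qed.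

Section TwoPoles.
Variables (n k : nat) (G : embedded_graph n).
Hypothesis Gk : closed_angulation G k.
Hypothesis k3 : (2 < k)%N.
Let t := #|faces G|.
Hypothesis t4 : (3 < t)%N.
Variables (u w : 'I_n).
Hypothesis uw : u != w.
Hypothesis poles : forall F, F \in faces G -> (u \in face_vertices F) && (w \in face_vertices F).

Let phi := face_next G.
Let g d j := (iter j phi d).1.

Lemma order_face d : d \in darts G -> fingraph.order phi d = k.
Proof. by move=> dG; rewrite -(angulation_walk_size Gk dG) size_map size_orbit. Qed.

Lemma iter_face d : d \in darts G -> iter k phi d = d.
Proof. by move=> dG; rewrite -{1}(order_face dG) iter_order //; exact: face_next_inj. Qed.

Lemma iter_dart d j : d \in darts G -> iter j phi d \in darts G.
Proof. by move=> dG; elim: j => //= j IH; rewrite face_next_dart. Qed.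

Lemma face_walk_iter d : d \in darts G -> face_walk G d = mkseq (g d) k.
Proof.
move=> dG; rewrite /face_walk /orbit -/phi order_face //.
apply: (@eq_from_nth _ d.1) => [|i]; rewrite size_map size_traject ?size_mkseq // => ik.
by rewrite (nth_map d) ?size_traject // nth_traject // nth_mkseq.
Qed.

Lemma walk_inj d i j : d \in darts G -> (i < k)%N -> (j < k)%N -> g d i = g d j -> i = j.
Proof.
move=> dG ik jk E; have := angulation_walk_uniq Gk dG; rewrite (face_walk_iter dG).
move=> /(uniqP (g d 0)); apply; rewrite ?inE ?size_mkseq //.
by rewrite !nth_mkseq.
Qed.

Lemma face_verticesP d v : d \in darts G ->
  reflect (exists2 j, (j < k)%N & v = g d j) (v \in face_vertices (face_of G d)).
Proof.
move=> dG; have -> : (v \in face_vertices (face_of G d)) = (v \in face_walk G d).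
  rewrite /face_vertices; apply/imsetP/mapP => -[c cO ->]; exists c => //; by rewrite inE in cO *.
rewrite face_walk_iter //; apply: (iffP mapP) => -[j jk ->]; exists j => //.
  by rewrite mem_iota in jk.
by rewrite mem_iota.
Qed.

(** For S = {u, w, v}, each face through [v] has excess 1, and the total excess is at most 2(3 -
    2). *)
Lemma few_faces v : v != u -> v != w ->
  (#|[set F in faces G | v \in face_vertices F]| <= 2)%N.
Proof.
move=> vu vw; pose S := [set u; w; v].
have S3 : #|S| = 3.
  rewrite /S finset.setUC cardsU1 cards2 uw !inE negb_or vu vw //.
have := face_excess (angulation_plane Gk) (angulation_walk_uniq Gk) (S := S); rewrite S3 => /(_ isT).
apply: leq_trans; rewrite -sum1dep_card big_mkcondr /=; apply: leq_sum => F FG.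
case: ifP => // vF; have /andP[uF wF] := poles FG.
suff -> : face_vertices F :&: S = S by rewrite S3.
by apply/finset.setIidPr/fintype.subsetP => x; rewrite !inE -orbA => /or3P[]/eqP->.
Qed.

(** Distinct neighbours of [v] give distinct faces at [v], so there are at most two, and a cyclic
    permutation of at most two elements is an involution. *)
Lemma rot_involutive v p : v != u -> v != w -> adj G v p ->
  Defs.rot G v (Defs.rot G v p) = p.
Proof.
move=> vu vw vp; pose N := [set q | adj G v q].
have N2 : (#|N| <= 2)%N.
  apply: leq_trans (few_faces vu vw).
  rewrite -(card_in_imset (f := fun q => face_of G (v, q)) (D := mem N)); last first.
    move=> q q'; rewrite !inE => vq vq' E.
    have := corner_inj (angulation_walk_uniq Gk) (c := (v, q)) (c' := (v, q')).
    by rewrite inE => /(_ vq erefl E)[].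
  apply: subset_leq_card; apply/fintype.subsetP => F /imsetP[q]; rewrite inE => vq ->.
  have vqG : (v, q) \in darts G by rewrite inE.
  rewrite inE face_of_in_faces //; apply/(face_verticesP _ vqG); exists 0%N => //.
  exact: leq_trans k3.
have [E|ne] := eqVneq (Defs.rot G v p) p; first by rewrite !E.
apply/eqP; apply: contraLR N2 => ne2; rewrite -ltnNge.
have ne3 : Defs.rot G v (Defs.rot G v p) != Defs.rot G v p by rewrite (inj_eq perm_inj).
apply: (@leq_trans #|[set p; Defs.rot G v p; Defs.rot G v (Defs.rot G v p)]|).
  by rewrite finset.setUC cardsU1 cards2 !inE negb_or ne2 ne3 eq_sym ne.
apply: subset_leq_card; apply/fintype.subsetP => x.
by rewrite !inE -orbA => /or3P[]/eqP->; rewrite ?adj_rot ?adj_rot.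
Qed.

(** For a dart at [u], the number of edges from [u] to [w] along the face walk. *)
Let len d := index w (face_walk G d).

Lemma pole_index_lt d : d \in darts G -> (len d < k)%N.
Proof.
move=> dG; rewrite -(angulation_walk_size Gk dG) index_mem.
have /andP[_] := poles (face_of_in_faces dG).
by rewrite -[face_vertices _]/(face_vertices (face_of G d)) => /(face_verticesP _ dG)[j jk ->]; rewrite face_walk_iter // map_f // mem_iota.
Qed.

Lemma walk_pole d : d \in darts G -> g d (len d) = w.
Proof.
move=> dG; have := pole_index_lt dG; rewrite -{1}(angulation_walk_size Gk dG) index_mem => /(nth_index u).
by rewrite -/(len d) {1}face_walk_iter // nth_mkseq // pole_index_lt.
Qed.

Lemma walk_pole_index d j : d \in darts G -> (j < k)%N -> g d j = w -> j = len d.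
Proof. by move=> dG jk E; apply: (walk_inj dG) => //; rewrite ?pole_index_lt // walk_pole. Qed.

Let back (d : 'I_n * 'I_n) := (d.1, (Defs.rot G d.1)^-1%g d.2).

Lemma backP d : d.1 = u -> phi ((back d).2, u) = d.
Proof. by case: d => x y /= ->; rewrite /phi /face_next /= permKV. Qed.

Lemma back_dart d : d \in darts G -> back d \in darts G.
Proof. by case: d => x y; rewrite !inE /= => /adj_rotV. Qed.

(** After [w], the face of [d] returns to [u] along the path that starts with [back d], in reverse:
    at inner vertices the rotation is an involution, so the walks on both sides of a path follow it
    up to the next pole. *)
Lemma iter_back d i : d \in darts G -> d.1 = u -> (i < k - len d)%N ->
  iter i phi (back d) = ((iter (k - i.+1) phi d).2, (iter (k - i.+1) phi d).1).
Proof.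
move=> dG du; elim: i => [|i IH] il.
  have E : iter (k - 1) phi d = ((back d).2, u).
    apply: (@face_next_inj _ G); rewrite -/phi backP // -iterS.
    have -> : (k - 1).+1 = k by lia.
    exact: iter_face.
  by rewrite /= E /= /back /= du.
rewrite iterS IH; last by lia.
have -> : (k - i.+1)%N = (k - i.+2).+1 by lia.
have := iter_dart (k - i.+2) dG.
have gE : g d (k - i.+2).+1 = (iter (k - i.+2) phi d).2 by [].
move: gE; rewrite iterS; case: (iter (k - i.+2) phi d) => x y /= gE; rewrite inE /= => xy.
have yu : y != u.
  apply/eqP => yu; have := @walk_inj d (k - i.+2).+1 0 dG.
  by rewrite gE yu /g /= du => H; suff: (k - i.+2).+1 = 0%N by []; apply: H => //; lia.
have yw : y != w.
  apply/eqP => yw; have := @walk_pole_index d (k - i.+2).+1 dG.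
  by rewrite gE => H; have := H _ yw; lia.
by rewrite /phi /face_next /= rot_involutive // adj_sym.
Qed.

Lemma walk_back d i : d \in darts G -> d.1 = u -> (i <= k - len d)%N ->
  g (back d) i = g d (k - i).
Proof.
case: i => [|i] dG du ik; first by rewrite /g subn0 iter_face.
by rewrite /g /= iter_back.
Qed.

Lemma pole_index_gt0 d : d.1 = u -> d \in darts G -> (0 < len d)%N.
Proof.
move=> du dG; rewrite lt0n; apply/eqP => l0.
by have := walk_pole dG; rewrite l0 /g /= du => E; move: uw; rewrite E eqxx.
Qed.

Lemma pole_index_back d : d \in darts G -> d.1 = u -> len (back d) = (k - len d)%N.
Proof.
move=> dG du; apply/esym/walk_pole_index; [exact: back_dart|by have := pole_index_gt0 du dG; lia|].
by rewrite walk_back // subKn ?walk_pole // ltnW // pole_index_lt.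
Qed.

Let inner d := [set v in [seq g d j | j <- iota 1 (len d).-1]].

Lemma innerP d v : d \in darts G ->
  reflect (exists2 j, (0 < j < len d)%N & v = g d j) (v \in inner d).
Proof.
move=> dG; rewrite inE; apply: (iffP mapP) => -[j jl ->]; exists j => //.
  by move: jl; rewrite mem_iota; lia.
by rewrite mem_iota; lia.
Qed.

Lemma inner_poles d v : d \in darts G -> d.1 = u -> v \in inner d -> (v != u) && (v != w).
Proof.
move=> dG du /(innerP _ dG)[j jl ->]; have lk := pole_index_lt dG; apply/andP; split.
  apply/eqP => ju; have : j = 0%N; last by lia.
  by apply: (walk_inj dG); rewrite ?ju /g //=; lia.
by apply/eqP => /(walk_pole_index dG); lia.
Qed.

Lemma card_inner d : d \in darts G -> #|inner d| = (len d).-1.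
Proof.
move=> dG; have lk := pole_index_lt dG; rewrite cardsE (card_uniqP _) ?size_map ?size_iota //.
rewrite map_inj_in_uniq ?iota_uniq // => i j; rewrite !mem_iota => ij jj.
by apply: walk_inj => //; lia.
Qed.

Lemma face_vertices_poles d : d \in darts G -> d.1 = u ->
  face_vertices (face_of G d) = [set u; w] :|: inner (back d) :|: inner d.
Proof.
move=> dG du; have bG := back_dart dG; have lk := pole_index_lt dG; have l0 := pole_index_gt0 du dG.
apply/setP => v; rewrite !finset.in_setU !finset.in_set1; apply/(face_verticesP _ dG)/idP => [[j jk ->]|].
  have [jl|jl|->] := ltngtP j (len d); last by rewrite walk_pole // eqxx orbT.
    case: j jk jl => [|j] jk jl; first by rewrite /g /= du eqxx.
    by rewrite (_ : _ \in inner d) ?orbT //; apply/(innerP _ dG); exists j.+1.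
  rewrite (_ : _ \in inner (back d)) ?orbT //; apply/(innerP _ bG); exists (k - j)%N.
    by rewrite pole_index_back //; lia.
  by rewrite walk_back //; [congr g|]; lia.
rewrite -!orbA => /or4P[/eqP->|/eqP->|/(innerP _ bG)[j]|/(innerP _ dG)[j jl ->]].
- by exists 0%N => //; lia.
- by exists (len d); rewrite ?walk_pole.
- by rewrite pole_index_back // => jl ->; exists (k - j)%N; rewrite ?walk_back //; lia.
- by exists j => //; lia.
Qed.


Variable a0 : 'I_n.
Hypothesis ua0 : adj G u a0.
(** Spokes in rotation order. As [back (D i.+1) = D i], it is [f i.+1] that lies between the paths i
    and i + 1. *)
Let D i := (u, iter i (Defs.rot G u) a0).
Let f i := face_of G (D i).
Let A i := inner (D i).

Lemma spoke_dart i : D i \in darts G.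
Proof. by rewrite inE /=; elim: i => //= i; exact: adj_rot. Qed.

Lemma back_spoke i : back (D i.+1) = D i.
Proof. by rewrite /back /= permK. Qed.

Lemma pole_index_spokeS i : len (D i.+1) = (k - len (D i))%N.
Proof.
have lk := pole_index_lt (spoke_dart i.+1); have := pole_index_back (spoke_dart i.+1) erefl.
by rewrite back_spoke => ->; lia.
Qed.

Lemma pole_index_spoke i : len (D i) = if odd i then (k - len (D 0))%N else len (D 0).
Proof.
have lk := pole_index_lt (spoke_dart 0).
by elim: i => //= i IH; rewrite pole_index_spokeS IH; case: (odd i) => //=; lia.
Qed.

Lemma face_spoke c F : F \in faces G -> c \in F -> c.1 = u -> F = face_of G c /\ adj G u c.2.
Proof.
move=> FG; rewrite (face_ofP _ FG) => /andP[cG /eqP<-] cu; split=> //.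
by move: cG; rewrite inE cu.
Qed.

(** Every face has exactly one corner at [u]. *)
Lemma degree_pole : #|porbit (Defs.rot G u) a0| = t.
Proof.
have -> : #|porbit (Defs.rot G u) a0| = #|[set q | adj G u q]|.
  by apply: eq_card => q; rewrite inE; exact: rot_cyclic.
rewrite -(card_in_imset (f := fun q => face_of G (u, q)) (D := mem [set q | adj G u q])); last first.
  move=> q q'; rewrite !inE => vq vq' E.
  have := corner_inj (angulation_walk_uniq Gk) (c := (u, q)) (c' := (u, q')).
  by rewrite inE => /(_ vq erefl E)[].
apply: eq_card => F; apply/imsetP/idP => [[q]|FG].
  by rewrite inE => uq ->; apply: face_of_in_faces; rewrite inE.
have /andP[/imsetP[c cF cu] _] := poles FG.
have [-> uc] := face_spoke FG cF (esym cu); exists c.2; first by rewrite inE.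
by rewrite cu -surjective_pairing.
Qed.

Lemma spoke_mod i : D (i %% t) = D i.
Proof.
rewrite [in RHS](divn_eq i t) addnC; congr pair; rewrite iterD; congr iter.
elim: (i %/ t)%N => // m IH; rewrite mulSn iterD -IH.
by rewrite -[in iter t](degree_pole) iter_porbit.
Qed.

Lemma spoke_inj i j : (i < t)%N -> (j < t)%N -> D i = D j -> i = j.
Proof.
move=> it jt [E]; have := uniq_traject_porbit (Defs.rot G u) a0; rewrite degree_pole.
move=> /(uniqP a0); apply; rewrite ?inE ?size_traject //.
by rewrite !nth_traject.
Qed.

Lemma spoke_onto c F : F \in faces G -> c \in F -> c.1 = u -> exists2 i, (i < t)%N & c = D i.
Proof.
move=> FG cF cu; have [_] := face_spoke FG cF cu.
rewrite -(rot_cyclic _ ua0) porbit_traject degree_pole => /trajectP[i it ci].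
by exists i => //; rewrite /D -ci -cu -surjective_pairing.
Qed.

Lemma face_spokeP F : F \in faces G -> exists2 i, (i < t)%N & F = f i.+1.
Proof.
move=> FG; have /andP[/imsetP[c cF cu] _] := poles FG.
have [i it cE] := spoke_onto FG cF (esym cu).
have [FE _] := face_spoke FG cF (esym cu).
exists ((i + t - 1) %% t)%N; first by rewrite ltn_mod; lia.
have itE : (i + t - 1 + 1 = i + t)%N by lia.
by rewrite /f -spoke_mod -addn1 modnDml itE modnDr modn_small // -cE.
Qed.

Lemma face_spoke_inj i j : f i = f j -> i = j %[mod t].
Proof.
move=> E; apply: spoke_inj; rewrite ?ltn_mod ?(leq_trans _ t4) //.
by rewrite !spoke_mod; apply: (corner_inj (angulation_walk_uniq Gk)) => //; exact: spoke_dart.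
Qed.

Lemma spoke_face_vertices i : face_vertices (f i.+1) = [set u; w] :|: A i :|: A i.+1.
Proof. by rewrite face_vertices_poles ?spoke_dart // back_spoke. Qed.

(** A common vertex lies on the faces i, i + 1, j and j + 1, of which at most two are distinct;
    modulo t > 2 this forces i = j. *)
Lemma spoke_disjoint i j v : (i < t)%N -> (j < t)%N -> v \in A i -> v \in A j -> i = j.
Proof.
move=> it jt vi vj; have /andP[vu vw] := inner_poles (spoke_dart i) erefl vi.
have vF m : v \in A m -> f m \in [set F in faces G | v \in face_vertices F] /\
    f m.+1 \in [set F in faces G | v \in face_vertices F].
  move=> vm; rewrite !inE !face_of_in_faces ?spoke_dart //= spoke_face_vertices.
  split; last by rewrite !finset.in_setU vm orbT.
  have -> : f m = f (m + t - 1).+1.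
    have -> : (m + t - 1).+1 = (m + t)%N by lia.
    by rewrite /f -(spoke_mod (m + t)) modnDr spoke_mod.
  rewrite spoke_face_vertices; have -> : A (m + t - 1).+1 = A m.
    have -> : (m + t - 1).+1 = (m + t)%N by lia.
    by rewrite /A -(spoke_mod (m + t)) modnDr spoke_mod.
  by rewrite !finset.in_setU vm orbT.
have [fi fi1] := vF i vi; have [fj fj1] := vF j vj.
have fii1 : f i != f i.+1.
  by apply/eqP => /face_spoke_inj; rewrite modn_small //; apply: modn_succ_neq => //; exact: leq_trans t4.
have FE : [set f i; f i.+1] = [set F in faces G | v \in face_vertices F].
  apply/eqP; rewrite eqEcard cards2 fii1 few_faces // andbT.
  by apply/fintype.subsetP => F; rewrite finset.in_set2 => /orP[]/eqP->.
move: fj fj1; rewrite -FE !finset.in_set2 => /orP[]/eqP/face_spoke_inj.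
  by rewrite !modn_small.
rewrite (modn_small jt) => jE /orP[]/eqP/face_spoke_inj E.
  by rewrite (modn_small it) in E; case: (modn_succ_neq2 (leq_trans (isT : 2 < 4) t4) it jE (esym E)).
by rewrite -jE in E; case: (modn_succ_neq (leq_trans (isT : 1 < 4) t4) jt (esym E)).
Qed.

Lemma spoke_cover v : v != u -> v != w -> exists2 i, (i < t)%N & v \in A i.
Proof.
move=> vu vw; have [e + ve] := face_hypergraph_cover Gk v.
rewrite face_hypergraphE => /imsetP[F FG eE]; rewrite eE in ve.
have [i it FE] := face_spokeP FG.
move: ve; rewrite FE spoke_face_vertices !finset.in_setU !finset.in_set1 (negPf vu) (negPf vw) /=.
case/orP => vA; first by exists i.
by exists (i.+1 %% t)%N; rewrite ?ltn_mod ?(leq_trans _ t4) // /A spoke_mod.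
Qed.

Let c v := if v == u then t else if v == w then t.+1 else find (fun i => v \in A i) (iota 0 t).

Let c_path v i : (i < t)%N -> (c v == i) = (v \in A i).
Proof.
move=> it; rewrite /c; have [->|vu] := eqVneq v u.
  rewrite gtn_eqF //; apply/esym/negbTE/negP => /(inner_poles (spoke_dart i) erefl).
  by rewrite eqxx.
have [->|vw] := eqVneq v w.
  rewrite gtn_eqF ?leqW //; apply/esym/negbTE/negP => /(inner_poles (spoke_dart i) erefl).
  by rewrite eqxx andbF.
have [j jt vj] := spoke_cover vu vw.
have hs : has (fun i => v \in A i) (iota 0 t) by apply/hasP; exists j; rewrite // mem_iota.
have := nth_find 0 hs; move: hs; rewrite has_find size_iota => ft.
rewrite nth_iota // add0n => vf; apply/eqP/idP => [<- //|vi].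
exact: spoke_disjoint vf vi.
Qed.

Let c_light v : v != u -> v != w -> (c v < t)%N.
Proof.
move=> vu vw; have [i it] := spoke_cover vu vw.
by rewrite -c_path // => /eqP->.
Qed.

Lemma two_poles_theta : theta_hypergraph k t (len (D 0)) (face_hypergraph G).
Proof.
have cu : c u = t by rewrite /c eqxx.
have cw : c w = t.+1 by rewrite /c eqxx eq_sym (negPf uw).
exists c; split=> [v|i it2|].
- have [->|vu] := eqVneq v u; first by rewrite cu leqW.
  have [->|vw] := eqVneq v w; first by rewrite cw.
  by have := c_light vu vw; move: (c v) => m; lia.
- case: ltnP => it.
    rewrite -pole_index_spoke -card_inner ?spoke_dart //; apply: eq_card => v.
    by rewrite [LHS]inE c_path.
  have [iE|iE] : i = t \/ i = t.+1 by lia.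
    rewrite -(cards1 u); apply: eq_card => v; rewrite !inE iE.
    have [->|vu] := eqVneq v u; first by rewrite cu eqxx.
    have [->|vw] := eqVneq v w; first by rewrite cw gtn_eqF.
    by rewrite ltn_eqF // c_light.
  rewrite -(cards1 w); apply: eq_card => v; rewrite !inE iE.
  have [->|vw] := eqVneq v w; first by rewrite cw eqxx.
  have [->|vu] := eqVneq v u; first by rewrite cu ltn_eqF.
  by rewrite ltn_eqF // leqW // c_light.
have fE i : (i < t)%N -> face_vertices (f i.+1) = theta_edge t c i.
  move=> it; apply/setP => v; rewrite spoke_face_vertices !finset.in_setU !finset.in_set1 [RHS]inE.
  have [->|vu] := eqVneq v u; first by rewrite cu leqnn.
  have [->|vw] := eqVneq v w; first by rewrite cw leqW.
  have i1t : (i.+1 %% t < t)%N by rewrite ltn_mod (leq_trans _ t4).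
  by rewrite leqNgt c_light //= !c_path // /A spoke_mod.
rewrite face_hypergraphE; apply/setP => e; apply/imsetP/imsetP => [[F FG ->]|[i _ ->]].
  by have [i it ->] := face_spokeP FG; exists (Ordinal it); rewrite ?fE.
by exists (f i.+1); rewrite ?fE // face_of_in_faces // spoke_dart.
Qed.

(** Path 2 has the same length as path 0; if both had length 1, both spokes would be the dart (u,
    w). *)
Lemma first_length_gt1 : (1 < len (D 0))%N.
Proof.
have l0 := pole_index_gt0 (erefl : (D 0).1 = u) (spoke_dart 0).
rewrite ltn_neqAle l0 andbT; apply/eqP => l1.
have end1 m : len (D m) = 1%N -> D m = (u, w).
  by move=> lm; have := walk_pole (spoke_dart m); rewrite lm /g /= => <-.
have l2 : len (D 2) = 1%N by rewrite pole_index_spoke.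
have : D 0 = D 2 by rewrite (end1 0 (esym l1)) (end1 2 l2).
by move/spoke_inj; rewrite !(leq_trans _ t4) // => /(_ isT isT).
Qed.

(** After an odd number t of spokes the lengths have been exchanged, yet the spoke is the initial
    one. *)
Lemma odd_length : odd t -> (2 * len (D 0) = k)%N.
Proof.
move=> ot; have := pole_index_spoke t; rewrite ot -(spoke_mod t) modnn.
by have := pole_index_lt (spoke_dart 0); lia.
Qed.

End TwoPoles.

(** Starting from the next spoke exchanges a and k - a, so the smaller of the two can be taken as
    the parameter. *)
Lemma two_poles_angulation n k (G : embedded_graph n) (u w : 'I_n) :
  closed_angulation G k -> (2 < k)%N -> (3 < #|faces G|)%N -> u != w ->
  (forall e, e \in face_hypergraph G -> (u \in e) && (w \in e)) ->
  exists a, [/\ (1 < a)%N, (2 * a <= k)%N, odd #|faces G| -> (2 * a)%N = k &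
    theta_hypergraph k #|faces G| a (face_hypergraph G)].
Proof.
move=> Gk k3 t4 uw poles.
have poles' F : F \in faces G -> (u \in face_vertices F) && (w \in face_vertices F).
  by move=> FG; apply: poles; rewrite face_hypergraphE; apply/imsetP; exists F.
have [a ua] := angulation_neighbour Gk u.
have ub := adj_rot ua.
have ta := two_poles_theta Gk k3 t4 uw poles' ua.
have tb := two_poles_theta Gk k3 t4 uw poles' ub.
have ga := first_length_gt1 Gk k3 t4 uw poles' ua.
have gb := first_length_gt1 Gk k3 t4 uw poles' ub.
have oa := odd_length Gk k3 t4 uw poles' ua.
have ob := odd_length Gk k3 t4 uw poles' ub.
have ab := pole_index_spokeS Gk k3 t4 uw poles' ua 0.
rewrite /= in ta tb ga gb oa ob ab.
rewrite ab in tb gb ob.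
have [le|gt] := leqP (2 * index w (face_walk G (u, a))) k.
  by exists (index w (face_walk G (u, a))).
exists (k - index w (face_walk G (u, a)))%N; split=> //; lia.
Qed.

Lemma equal_fibers_perm n (c1 c2 : 'I_n -> nat) :
  (forall i, #|[set v | c1 v == i]| = #|[set v | c2 v == i]|) ->
  exists p : {perm 'I_n}, forall v, c2 (p v) = c1 v.
Proof.
move=> E; pose s c := [tuple c v | v < n] : n.-tuple nat.
have countE c i : count_mem i (s c) = #|[set v | c v == i]|.
  by rewrite count_map -sum1_count -sum1dep_card big_enum_cond.
have /tuple_permP[p sE] : perm_eq (s c1) (s c2).
  by apply/allP => i _ /=; rewrite !countE E.
exists p => v; have := congr1 (fun r : n.-tuple nat => tnth r v) (val_inj sE).
by rewrite !tnth_mktuple.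
Qed.

Lemma eq_or_and (T : eqType) (x y z m : T) : x != z ->
  ((m == x) || (m == y)) && ((m == y) || (m == z)) = (m == y).
Proof.
move=> xz; have [->|my] := eqVneq m y; first by rewrite orbT.
by have [->|mx] := eqVneq m x; rewrite //= (negPf xz).
Qed.

(** * Edges and intersections in theta hypergraphs *)

Section ThetaHypergraphs.
Variables (n k t a : nat).
Hypotheses (t4 : (3 < t)%N) (a1 : (1 < a)%N) (ak : (2 * a <= k)%N) (oddt : odd t -> (2 * a)%N = k).
Variables (H : hypergraph n) (c : 'I_n -> nat).
Hypothesis c_lt : forall v, (c v < t.+2)%N.
Hypothesis c_card : forall i, (i < t.+2)%N -> #|[set v | c v == i]| =
  if (i < t)%N then (if odd i then k - a else a).-1 else 1%N.
Hypothesis HE : H = [set theta_edge t c i | i : 'I_t].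

Let fibre i := [set v | c v == i].
Let poles := [set v | (t <= c v)%N].

Lemma card_theta_poles : #|poles| = 2.
Proof.
have -> : poles = fibre t :|: fibre t.+1.
  by apply/setP => v; rewrite !inE; have := c_lt v; move: (c v) => m; lia.
rewrite cardsU !c_card ?leqnSn // !ltnNge leqnSn leqnn /=.
rewrite (_ : _ :&: _ = finset.set0) ?cards0 //.
by apply/setP => v; rewrite !inE; move: (c v) => m; lia.
Qed.

Lemma card_poles_fibre i : (i < t)%N -> #|poles :|: fibre i| = (if odd i then k - a else a).+1.
Proof.
move=> it; rewrite cardsU card_theta_poles c_card ?it; last by lia.
rewrite (_ : _ :&: _ = finset.set0) ?cards0; first by case: (odd i); lia.
by apply/setP => v; rewrite !inE; move: (c v) => m; lia.
Qed.

Lemma fibre_neq0 i : (i < t)%N -> exists v, c v = i.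
Proof.
move=> it; have /card_gt0P[v] : (0 < #|fibre i|)%N.
  by rewrite c_card ?it; [case: (odd i); lia|lia].
by rewrite inE => /eqP; exists v.
Qed.

Lemma theta_edgeE i : theta_edge t c i = poles :|: fibre i :|: fibre (i.+1 %% t).
Proof. by apply/setP => v; rewrite !inE orbA. Qed.

Lemma card_theta_edge i : (i < t)%N -> #|theta_edge t c i| = k.
Proof.
move=> it; have it1 : (i.+1 %% t < t)%N by rewrite ltn_mod; lia.
rewrite theta_edgeE cardsU card_poles_fibre // c_card ?it1; last by lia.
have neq := modn_succ_neq (leq_trans (isT : 1 < 4) t4) it.
rewrite (_ : _ :&: _ = finset.set0) ?cards0; last first.
  by apply/setP => v; rewrite !inE; move: (c v) neq it1 => m; lia.
rewrite modn_succ //; case: eqP => [E|_] /=; last by case: (odd i) => /=; lia.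
move: (oddt); rewrite -E /=; case: (odd i) => /= [|/(_ isT)]; lia.
Qed.

(** The paths have inner vertices, so an edge determines its pair of consecutive indices, and for t
    > 2 the pair determines the first one. *)
Lemma theta_edge_inj i j : (i < t)%N -> (j < t)%N -> theta_edge t c i = theta_edge t c j -> i = j.
Proof.
move=> it jt E; have it1 : (i.+1 %% t < t)%N by rewrite ltn_mod; lia.
have memE m : (m < t)%N -> (m == i) || (m == i.+1 %% t) = (m == j) || (m == j.+1 %% t).
  move=> mt; have [v vm] := fibre_neq0 mt.
  by have /setP/(_ v) := E; rewrite !inE vm leqNgt mt.
have := memE i it; rewrite eqxx => /esym/orP[/eqP //|/eqP iE].
have := memE _ it1; rewrite eqxx orbT => /esym/orP[/eqP ij|/eqP ij].
  by case: (modn_succ_neq2 (leq_trans (isT : 2 < 4) t4) it (esym ij) iE).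
by case: (modn_succ_neq (leq_trans (isT : 1 < 4) t4) it); rewrite ij.
Qed.

Lemma card_theta : #|H| = t.
Proof.
rewrite HE card_imset ?card_ord // => i j E; apply: val_inj.
exact: theta_edge_inj E.
Qed.

(** The edges on both sides of path 0 share its a - 1 inner vertices and the poles. This size is
    what makes [a] an isomorphism invariant. *)
Lemma theta_inter_first : #|theta_edge t c t.-1 :&: theta_edge t c 0| = a.+1.
Proof.
have t0 : (0 < t)%N by lia.
rewrite -[RHS](card_poles_fibre t0); congr #|pred_of_set _|; apply/setP => v.
rewrite !inE prednK // modnn (modn_small (_ : 1 < t)%N) //; last by lia.
by move: (c v) => m; lia.
Qed.

Lemma theta_inter e e' : e \in H -> e' \in H -> e != e' ->
  [\/ #|e :&: e'| = 2, #|e :&: e'| = a.+1 | #|e :&: e'| = (k - a).+1].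
Proof.
rewrite HE => /imsetP[i _ ->] /imsetP[j _ ->] ne.
have ij : nat_of_ord i <> j by move=> ij; rewrite ij eqxx in ne.
have [it jt] := (ltn_ord i, ltn_ord j).
have card_fibre (m : nat) : (m < t)%N -> #|poles :|: fibre m| = a.+1 \/ #|poles :|: fibre m| = (k - a).+1.
  by move=> mt; rewrite card_poles_fibre //; case: odd; [right|left].
have ineq := modn_succ_neq (leq_trans (isT : 1 < 4) t4) it.
have jneq := modn_succ_neq (leq_trans (isT : 1 < 4) t4) jt.
have ijneq := @modn_succ_neq2 t i j (leq_trans (isT : 2 < 4) t4) it.
have jineq := @modn_succ_neq2 t j i (leq_trans (isT : 2 < 4) t4) jt.
have ij1 : (i.+1 %% t = j.+1 %% t) -> i = j :> nat.
  by rewrite !modn_succ //; do 2!case: eqP; clear; lia.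
have [E|N1] := eqVneq (nat_of_ord j) (i.+1 %% t).
  suff -> : theta_edge t c i :&: theta_edge t c j = poles :|: fibre j.
    by have [->|->] := card_fibre j jt; [apply: Or32|apply: Or33].
  apply/setP => v; rewrite !inE -E; move: (c v) => m.
  by case: (t <= m)%N => //=; apply: eq_or_and; apply/eqP; exact: ijneq.
have [E|N2] := eqVneq (nat_of_ord i) (j.+1 %% t).
  suff -> : theta_edge t c i :&: theta_edge t c j = poles :|: fibre i.
    by have [->|->] := card_fibre i it; [apply: Or32|apply: Or33].
  apply/setP => v; rewrite !inE -E; move: (c v) => m.
  case: (t <= m)%N => //=; rewrite andbC; apply: eq_or_and; apply/eqP; exact: jineq.
apply: Or31; rewrite -card_theta_poles; congr #|pred_of_set _|; apply/setP => v; rewrite !inE.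
case: (t <= c v)%N => //=; apply/negbTE/negP => /andP[/orP[]/eqP-> /orP[]/eqP].
- exact: ij.
- by move/eqP; rewrite (negPf N2).
- by move/eqP; rewrite eq_sym (negPf N1).
- by move/ij1/ij.
Qed.

Section Attained.
Local Open Scope ring_scope.
Variables (R : realType) (s z : R).
Hypotheses (s0 : 0 < s) (z0 : 0 < z).
Hypotheses (sk : s ^+ k * k%:R = 1) (zk : z ^+ k * (k%:R * t%:R / 2) = 1).
Hypothesis tn : (t * (k - 2) = 2 * (n - 2))%N.

(** With [s] at the poles and [z] elsewhere, all edges have the same product whatever [a] is, and
    [tn] makes the k-th powers sum to 1. *)
Lemma theta_attains : exists2 x : 'rV[R]_n, unit_nonneg k x &
  hyper_form k H x = k%:R * (s ^+ 2 * z ^+ (k - 2)) * t%:R.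
Proof.
pose x : 'rV[R]_n := \row_v (if v \in poles then s else z).
have kR : 0 < k%:R :> R by rewrite ltr0n; lia.
have tR : 0 < t%:R :> R by rewrite ltr0n; lia.
have sE : s ^+ k = k%:R^-1 by apply: (mulIf (lt0r_neq0 kR)); rewrite sk mulVf // lt0r_neq0.
have zE : z ^+ k = 2 / (k%:R * t%:R).
  have kt0 : k%:R * t%:R / 2 != 0 :> R by rewrite lt0r_neq0 // divr_gt0 // mulr_gt0.
  by apply: (mulIf kt0); rewrite zk; field; rewrite !lt0r_neq0.
have n2 : (2 <= n)%N.
  by rewrite -card_theta_poles -[X in (_ <= X)%N]card_ord; apply: max_card.
have tnR : t%:R * (k%:R - 2) = 2 * (n%:R - 2) :> R.
  by rewrite -!natrB -?natrM ?tn //; lia.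
exists x.
  split=> [v|]; first by rewrite mxE; case: ifP => _; exact: ltW.
  rewrite (bigID (mem poles)) /= (eq_bigr (fun=> k%:R^-1)) => [|v vp]; last by rewrite mxE vp.
  rewrite [X in _ + X](eq_bigr (fun=> 2 / (k%:R * t%:R))) => [|v vp]; last first.
    by rewrite mxE (negPf vp).
  rewrite !sumr_const card_theta_poles.
  have -> : #|[pred v | v \notin poles]| = (n - 2)%N.
    have := cardC (mem poles); rewrite card_theta_poles card_ord.
    by rewrite (_ : #|[predC mem poles]| = #|[pred v | v \notin poles]|); [lia | exact: eq_card].
  rewrite -[X in _ + X]mulr_natl natrB // mulrA [_ * 2]mulrC -tnR.
  by field; rewrite !lt0r_neq0.
rewrite /hyper_form -mulrA; congr (_ * _).
rewrite (eq_bigr (fun=> s ^+ 2 * z ^+ (k - 2))) ?sumr_const ?card_theta ?mulr_natr //.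
rewrite HE => e /imsetP[i _ ->].
have pe : poles \subset theta_edge t c i by apply/fintype.subsetP => v; rewrite !inE => ->.
rewrite (big_setID poles) /= (finset.setIidPr pe) (eq_bigr (fun=> s)) => [|v vp]; last by rewrite mxE vp.
rewrite [X in _ * X](eq_bigr (fun=> z)) => [|v]; last by rewrite finset.in_setD mxE => /andP[/negPf->].
by rewrite !prodr_const cardsD (finset.setIidPr pe) card_theta_edge // card_theta_poles.
Qed.

End Attained.

End ThetaHypergraphs.

(** The fibre sizes depend only on k, t and a, so a permutation matches the two labellings. *)
Lemma theta_isomorphic n k t a (H1 H2 : hypergraph n) :
  theta_hypergraph k t a H1 -> theta_hypergraph k t a H2 -> isomorphic H1 H2.
Proof.
move=> [c1 [lt1 card1 ->]] [c2 [lt2 card2 ->]].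
have [|p pE] := @equal_fibers_perm n c1 c2.
  move=> i; have [it|ti] := ltnP i t.+2; first by rewrite card1 ?card2.
  have none (c : 'I_n -> nat) : (forall v, (c v < t.+2)%N) -> #|[set v | c v == i]| = 0%N.
    move=> c_lt; apply: eq_card0 => v; rewrite !inE ltn_eqF //.
    exact: leq_trans (c_lt v) ti.
  by rewrite !none.
exists p; have edgeE i : p @: theta_edge t c1 i = theta_edge t c2 i.
  apply/setP => v; rewrite -(permKV p v) mem_imset; last exact: perm_inj.
  by rewrite !inE pE.
apply/setP => e; apply/imsetP/imsetP => [[_ /imsetP[i _ ->] ->]|[i _ ->]].
  by exists i; rewrite ?edgeE.
by exists (theta_edge t c1 i); [apply/imsetP; exists i | rewrite edgeE].
Qed.

(** The intersection of size a + 1 is carried to one of size 2, b + 1 or k - b + 1. The first is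
    excluded by a > 1; in the last case a + b = k, and both being at most k/2 they are equal. *)
Lemma theta_isomorphic_eq n k t a b (H1 H2 : hypergraph n) :
  (3 < t)%N -> (1 < a)%N -> (2 * a <= k)%N -> (1 < b)%N -> (2 * b <= k)%N ->
  ~~ odd t -> theta_hypergraph k t a H1 -> theta_hypergraph k t b H2 -> isomorphic H1 H2 -> a = b.
Proof.
move=> t4 a1 ak b1 bk /negP even_t [c1 [lt1 card1 H1E]] [c2 [lt2 card2 H2E]] [p pE].
have [odda oddb] : (odd t -> (2 * a)%N = k) /\ (odd t -> (2 * b)%N = k) by [].
pose e := theta_edge t c1 t.-1; pose e' := theta_edge t c1 0.
have eH : e \in H1 by rewrite H1E; apply/imsetP; exists (Ordinal (ltac:(lia) : t.-1 < t)%N).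
have e'H : e' \in H1 by rewrite H1E; apply/imsetP; exists (Ordinal (ltac:(lia) : 0 < t)%N).
have ee' : p @: e != p @: e'.
  rewrite (inj_eq (imset_inj perm_inj)); apply/eqP => /(theta_edge_inj t4 a1 ak odda card1).
  by move=> /(_ ltac:(lia) ltac:(lia)); lia.
have [||E|E|E] := theta_inter t4 b1 bk oddb lt2 card2 H2E _ _ ee'.
- by rewrite -pE; apply/imsetP; exists e.
- by rewrite -pE; apply/imsetP; exists e'.
all: move: E; rewrite -imsetI ?card_imset; try exact: perm_inj.
all: try by move=> x y _ _; exact: perm_inj.
all: by rewrite (theta_inter_first t4 a1 ak odda lt1 card1); lia.
Qed.

(** * Existence of the extremal angulations *)

Section RotationLists.
Variables (n : nat) (nbrs : 'I_n -> seq 'I_n).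
Hypothesis nbrs_uniq : forall v, uniq (nbrs v).
Hypothesis nbrs_sym : forall v a, (a \in nbrs v) = (v \in nbrs a).
Hypothesis nbrs_irr : forall v, v \notin nbrs v.

Let nadj : rel 'I_n := [rel v a | a \in nbrs v].

Definition next_perm v : {perm 'I_n} := perm (can_inj (prev_next (nbrs_uniq v))).

Lemma next_permE v a : next_perm v a = next (nbrs v) a.
Proof. by rewrite permE. Qed.

Let nadj_sym : symmetric nadj. Proof. by move=> v a; exact: nbrs_sym. Qed.
Let nadj_irr : irreflexive nadj. Proof. by move=> v; apply/negbTE; exact: nbrs_irr. Qed.

Let next_perm_cyclic v a b : nadj v a -> (b \in porbit (next_perm v) a) = nadj v b.
Proof.
move=> va; have iterE i x : (next_perm v ^+ i)%g x = iter i (next (nbrs v)) x.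
  by rewrite permX; apply: eq_iter => y; exact: next_permE.
rewrite -[RHS](fconnect_cycle (cycle_next (nbrs_uniq v)) va).
apply/porbitP/idP => [[i ->]|]; first by rewrite iterE fconnect_iter.
by move/iter_findex => <-; exists (findex (next (nbrs v)) a b); rewrite iterE.
Qed.

Definition list_graph : embedded_graph n := EmbeddedGraph nadj_sym nadj_irr next_perm_cyclic.

End RotationLists.

Lemma next_mkseq (T : eqType) (h : nat -> T) t i : uniq (mkseq h t) -> (i < t)%N ->
  next (mkseq h t) (h i) = h (i.+1 %% t)%N.
Proof.
move=> U it; have hi : h i = nth (h 0%N) (mkseq h t) i by rewrite nth_mkseq.
have hin : h i \in mkseq h t by rewrite map_f // mem_iota.
have idx : index (h i) (mkseq h t) = i by rewrite hi index_uniq // size_mkseq.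
case: t U it hi hin idx => [//|t] U it hi hin idx.
rewrite next_nth hin idx /mkseq /= modn_succ // eqSS.
case: eqP => [->|/eqP ne]; first by rewrite nth_default // size_map size_iota.
have lt : (i < t)%N by rewrite ltn_neqAle ne -ltnS.
by rewrite (nth_map 0%N) ?size_iota // nth_iota // add1n.
Qed.

Lemma orbit_traject (T : finType) (f : T -> T) x m y : (0 < m)%N -> iter m f x = x ->
  uniq (traject f x m) -> y \in traject f x m ->
  exists r, orbit f y = seq.rot r (traject f x m).
Proof.
case: m => // m _ fx U y_in; have fc : fcycle f (traject f x m.+1).
  rewrite /= -[x in rcons _ x]fx iterSr -trajectSr; exact: fpath_traject.
by have [r ->] := orbit_rot_cycle fc U y_in; exists r.
Qed.

Lemma face_walk_cycle n (G : embedded_graph n) d : d \in darts G -> cycle (adj G) (face_walk G d).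
Proof.
move=> dG; pose e : rel ('I_n * 'I_n) := [rel c c' | (c \in darts G) && (c' == face_next G c)].
have : cycle e (orbit (face_next G) d).
  apply: (@sub_in_cycle _ (mem (darts G)) (frel (face_next G))); last exact: cycle_orbit (@face_next_inj _ G) d.
    by move=> c c' cG _ /= /eqP <-; apply/andP; split.
  apply/allP => c; rewrite -fconnect_orbit => dc.
  by apply: (face_of_sub dG); rewrite mem_face_of.
apply: homo_cycle => c c' /andP[cG /eqP->] /=.
by move: cG; rewrite inE.
Qed.

(** * The graph of t internally disjoint paths between two poles *)

Section ThetaGraph.
Variables (n k t : nat) (l : nat -> nat).
Hypotheses (t4 : (3 < t)%N) (l1 : forall i, (1 < l i)%N).
Hypothesis lk : forall i, (i < t)%N -> (l i + l (i.+1 %% t) = k)%N.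
Hypotheses (n2 : (1 < n)%N) (tn : (t * (k - 2) = 2 * (n - 2))%N).

Let s := [seq (i, j) | i <- iota 0 t, j <- iota 1 (l i).-1].

Let in_s i j : ((i, j) \in s) = (i < t)%N && (0 < j < l i)%N.
Proof.
apply/idP/idP => [/allpairsPdep[i' [j' [+ + [-> ->]]]]|/andP[it jl]].
  by rewrite !mem_iota; lia.
apply/allpairsPdep; exists i, j; rewrite !mem_iota.
by split=> //; move: (l1 i) jl; lia.
Qed.

Let s_uniq : uniq s.
Proof.
apply: allpairs_uniq_dep; [exact: iota_uniq|by move=> i _; exact: iota_uniq|].
by move=> [i j] [i' j'] _ _ /= [-> ->].
Qed.

(** Adding the total to its cyclic shift pairs consecutive paths, which together have k - 2 inner
    vertices. *)
Let s_size : size s = (n - 2)%N.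
Proof.
have sE : size s = (\sum_(i < t) (l i).-1)%N.
  rewrite size_allpairs_dep sumnE big_map -(big_mkord xpredT (fun i => (l i).-1)) /index_iota subn0.
  by apply: eq_bigr => i _; rewrite size_iota.
have : (size s + size s = t * (k - 2))%N.
  rewrite {2}sE (reindex_inj (@ordS_inj t)) sE -big_split /=.
  rewrite (eq_bigr (fun=> (k - 2)%N)) ?sum_nat_const ?card_ord // => i _.
  by rewrite -(lk (ltn_ord i)); have := l1 i; have := l1 (i.+1 %% t); lia.
by rewrite tn; lia.
Qed.

Let node := option (option (seq_sub s)).

Let card_node : #|{: node}| = n.
Proof. by rewrite !card_option card_seq_sub // s_size; lia. Qed.

Let vert (x : node) : 'I_n := cast_ord card_node (enum_rank x).
Let code (v : 'I_n) : node := enum_val (cast_ord (esym card_node) v).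

Let vertK : cancel vert code.
Proof. by move=> x; rewrite /code /vert cast_ordK enum_rankK. Qed.
Let codeK : cancel code vert.
Proof. by move=> v; rewrite /code /vert enum_valK cast_ordKV. Qed.

(* V i j is the j-th vertex of the i-th path from u to w, for j <= l i. *)
Let V (i j : nat) : 'I_n := vert (if j == 0%N then None else Some (insub (i, j))).
Let u : 'I_n := vert None.
Let w : 'I_n := vert (Some None).
Let inside i j := (i < t)%N && (0 < j < l i)%N.

Let V0 i : V i 0 = u. Proof. by []. Qed.

(** The pair (i, l i) lies outside [s], so [insub] yields [None], and [Some None] is the code of
    [w]. *)
Let Vl i : V i (l i) = w.
Proof.
by rewrite /V gtn_eqF ?insubN // ?in_s ?ltnn ?andbF // ltnW.
Qed.

Let uw : u != w. Proof. by apply/eqP => /(can_inj vertK). Qed.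

Let code_inside i j (ij : inside i j) : code (V i j) = Some (insub (i, j)).
Proof. by rewrite /V gtn_eqF ?vertK //; case/and3P: ij. Qed.

Let insub_inside i j : inside i j -> exists x : seq_sub s, insub (i, j) = Some x /\ val x = (i, j).
Proof. by rewrite /inside -in_s => ij; case: insubP => [x _ xE|]; [exists x | rewrite ij]. Qed.

Let V_inj i j i' j' : inside i j -> inside i' j' -> V i j = V i' j' -> i = i' /\ j = j'.
Proof.
move=> ij ij' /(congr1 code); rewrite !code_inside // => -[].
have [x [-> xE]] := insub_inside ij; have [x' [-> xE']] := insub_inside ij'.
by move=> [xx']; move: xE; rewrite xx' xE' => -[].
Qed.

Let V_pole i j : inside i j -> (V i j != u) && (V i j != w).
Proof.
move=> ij; apply/andP; split; apply/eqP => /(congr1 code); rewrite code_inside // vertK //.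
by have [x [-> _]] := insub_inside ij.
Qed.

Let V_cases (P : 'I_n -> Prop) : P u -> P w -> (forall i j, inside i j -> P (V i j)) -> forall v, P v.
Proof.
move=> Pu Pw PV v; rewrite -(codeK v); case: (code v) => [[x|]|] //.
case xE: (val x) => [i j]; have := valP x; rewrite xE in_s => ij.
have := PV i j ij; rewrite /V gtn_eqF; last by case/and3P: ij.
by rewrite -xE valK.
Qed.

Let V_path_inj i j j' : (i < t)%N -> (j <= l i)%N -> (j' <= l i)%N -> V i j = V i j' -> j = j'.
Proof.
have aux j1 j2 : (i < t)%N -> (j1 < j2 <= l i)%N -> V i j1 <> V i j2.
  move=> it /andP[j12]; rewrite leq_eqVlt => /predU1P[j2E|j2l].
    rewrite j2E Vl; have [->|j10] := posnP j1; first by apply/eqP.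
    by have /andP[_ /eqP] : (V i j1 != u) && (V i j1 != w) by apply: V_pole; rewrite /inside it j10 /=; lia.
  have j20 : inside i j2 by rewrite /inside it j2l andbT; exact: leq_ltn_trans j12.
  have [->|j10] := posnP j1; first by have /andP[/eqP ne _] := V_pole j20; move/esym.
  have j1i : inside i j1 by rewrite /inside it j10 (ltn_trans j12).
  by move=> /(V_inj j1i j20)[_ E]; rewrite E ltnn in j12.
move=> it jl jl' E; case: (ltngtP j j') => // jj; [case: (aux j j') | case: (aux j' j)] => //.
  by rewrite jj.
by rewrite jj.
Qed.

(** Seen from [w], the paths occur in the opposite cyclic order, hence [rev]; this makes consecutive
    paths bound a face. *)
Let nbrs (v : 'I_n) : seq 'I_n :=
  match code v with
  | None => mkseq (fun i => V i 1) t
  | Some None => rev (mkseq (fun i => V i (l i).-1) t)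
  | Some (Some x) => let: (i, j) := val x in [:: V i j.-1; V i j.+1]
  end.

Let nbrs_u : nbrs u = mkseq (fun i => V i 1) t.
Proof. by rewrite /nbrs vertK. Qed.
Let nbrs_w : nbrs w = rev (mkseq (fun i => V i (l i).-1) t).
Proof. by rewrite /nbrs vertK. Qed.
Let nbrs_V i j : inside i j -> nbrs (V i j) = [:: V i j.-1; V i j.+1].
Proof. by move=> ij; rewrite /nbrs code_inside //; have [x [-> ->]] := insub_inside ij. Qed.

Let inside1 i : (i < t)%N -> inside i 1.
Proof. by move=> it; rewrite /inside it l1. Qed.
Let insidel i : (i < t)%N -> inside i (l i).-1.
Proof. by move=> it; rewrite /inside it; have := l1 i; lia. Qed.

Let first_uniq : uniq (mkseq (fun i => V i 1) t).
Proof.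
by apply/mkseq_uniqP => i j it jt; case/(V_inj (inside1 it) (inside1 jt)).
Qed.
Let last_uniq : uniq (mkseq (fun i => V i (l i).-1) t).
Proof.
by apply/mkseq_uniqP => i j it jt; case/(V_inj (insidel it) (insidel jt)).
Qed.

Let nbrs_uniq v : uniq (nbrs v).
Proof.
move: v; apply: V_cases => [||i j ij]; first by rewrite nbrs_u.
  by rewrite nbrs_w rev_uniq.
rewrite nbrs_V //= inE andbT; apply/eqP => /V_path_inj; case/and3P: ij => it j0 jl.
by move=> /(_ it); lia.
Qed.

Let nbrs_irr v : v \notin nbrs v.
Proof.
move: v; apply: V_cases => [||i j ij].
- rewrite nbrs_u; apply/mapP => -[i]; rewrite mem_iota => it uE.
  by have := V_pole (inside1 it); rewrite -uE eqxx.
- rewrite nbrs_w mem_rev; apply/mapP => -[i]; rewrite mem_iota => it wE.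
  by have := V_pole (insidel it); rewrite -wE eqxx andbF.
rewrite nbrs_V // !inE; case/and3P: ij => it j0 jl.
by apply/negP => /orP[]/eqP/V_path_inj => /(_ it); lia.
Qed.

Let nbrs_step i j : (i < t)%N -> (j < l i)%N ->
  (V i j.+1 \in nbrs (V i j)) && (V i j \in nbrs (V i j.+1)).
Proof.
move=> it jl; apply/andP; split.
  case: j jl => [|j] jl; last by rewrite nbrs_V ?/inside ?it //= !inE eqxx orbT.
  by rewrite V0 nbrs_u; apply/mapP; exists i; rewrite // mem_iota.
have [E|jl'] : j.+1 = l i \/ (j.+1 < l i)%N by lia.
  by rewrite E Vl nbrs_w mem_rev; apply/mapP; exists i; rewrite ?mem_iota // -E.
by rewrite nbrs_V ?/inside ?it //= inE eqxx.
Qed.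

Let nbrsP v a : a \in nbrs v -> exists i j, [/\ (i < t)%N, (j < l i)%N &
  (v = V i j /\ a = V i j.+1) \/ (v = V i j.+1 /\ a = V i j)].
Proof.
move: v; apply: V_cases => [||i j ij].
- rewrite nbrs_u => /mapP[i]; rewrite mem_iota => it ->; exists i, 0%N; split=> //; first exact: ltnW.
  by left.
- rewrite nbrs_w mem_rev => /mapP[i]; rewrite mem_iota => it ->; exists i, (l i).-1.
  have l1i := l1 i; rewrite prednK ?Vl; last by lia.
  by split=> //; last (by right); lia.
case/and3P: (ij) => it j0 jl; rewrite nbrs_V // !inE => /orP[]/eqP->.
  exists i, j.-1; rewrite prednK //; split=> //; first by lia.
  by right.
by exists i, j; split=> //; left.
Qed.

Let nbrs_sym v a : (a \in nbrs v) = (v \in nbrs a).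
Proof.
by apply/idP/idP => /nbrsP[i [j [it jl [[-> ->]|[-> ->]]]]]; have /andP[] := nbrs_step it jl.
Qed.

Let G : embedded_graph n := list_graph nbrs_uniq nbrs_sym nbrs_irr.

Let rot_inside i j : inside i j ->
  Defs.rot G (V i j) (V i j.-1) = V i j.+1 /\ Defs.rot G (V i j) (V i j.+1) = V i j.-1.
Proof.
move=> ij; rewrite !next_permE nbrs_V //=.
have := nbrs_uniq (V i j); rewrite nbrs_V //= inE andbT => /negPf ne.
by rewrite !eqxx eq_sym ne.
Qed.

Let rot_u i : (i < t)%N -> Defs.rot G u (V i 1) = V (i.+1 %% t) 1.
Proof. by move=> it; rewrite next_permE nbrs_u (next_mkseq (h := fun i => V i 1)). Qed.

Let rot_w i : (i < t)%N ->
  Defs.rot G w (V (i.+1 %% t) (l (i.+1 %% t)).-1) = V i (l i).-1.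
Proof.
move=> it; rewrite next_permE nbrs_w next_rev //.
by rewrite -(next_mkseq (h := fun i => V i (l i).-1)) // prev_next.
Qed.

(* Boundary walk of the face between the paths i and i + 1. *)
Let B i j := if (j <= l (i.+1 %% t))%N then V (i.+1 %% t) j else V i (k - j).

Let succ_lt i : (i.+1 %% t < t)%N. Proof. by rewrite ltn_mod; lia. Qed.

Let face_step i j : (i < t)%N -> (j.+1 < k)%N ->
  face_next G (B i j, B i j.+1) = (B i j.+1, B i j.+2).
Proof.
move=> it jk; have lk' := lk it; have l1i := l1 i; have l1i' := l1 (i.+1 %% t).
rewrite /face_next /=; congr pair; rewrite /B.
(* The walk is on its way to [w], on its way back, or turning at [w]. *)
have [lt|gt|E] := ltngtP j.+1 (l (i.+1 %% t)).
- have ij : inside (i.+1 %% t) j.+1 by rewrite /inside succ_lt lt.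
  rewrite (_ : (j <= _)%N); last by rewrite ltnW // ltnW.
  by have [] := rot_inside ij.
- have ij : inside i (k - j.+1) by rewrite /inside it; lia.
  have [_] := rot_inside ij.
  have -> : (k - j.+1).+1 = (k - j)%N by lia.
  have -> : (k - j.+1).-1 = (k - j.+2)%N by lia.
  (* On the first step after [w], the vertex [w], given as the end of path i + 1, is reread as the
     end of path i. *)
  case: leqP => [jl|_ //]; have {jl}E : j = l (i.+1 %% t) by lia.
  have -> : (k - j)%N = l i by lia.
  by rewrite E !Vl.
rewrite (_ : (j <= _)%N); last by rewrite -E.
rewrite E Vl; have := rot_w it; rewrite -E /= => ->.
by congr V; lia.
Qed.


Let k_gt3 : (3 < k)%N.
Proof. by rewrite -(lk (ltnW (ltnW (ltnW t4)))) (leq_add (l1 _) (l1 _)). Qed.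

Let start i := (B i 0, B i 1).

Let iter_start i j : (i < t)%N -> (j < k)%N ->
  iter j (face_next G) (start i) = (B i j, B i j.+1).
Proof. by move=> it; elim: j => //= j IH jk; rewrite IH ?face_step // ltnW. Qed.

Let B0 i : B i 0 = u. Proof. by rewrite /B leq0n. Qed.
Let B1 i : B i 1 = V (i.+1 %% t) 1. Proof. by rewrite /B ltnW. Qed.
Let Bw i : B i (l (i.+1 %% t)) = w. Proof. by rewrite /B leqnn Vl. Qed.

Let iter_k i : (i < t)%N -> iter k (face_next G) (start i) = start i.
Proof.
move=> it; have lk' := lk it; have l1i := l1 i.
have kE : k = k.-1.+1 by rewrite prednK // (ltn_trans _ k_gt3).
have -> : iter k (face_next G) (start i) = face_next G (iter k.-1 (face_next G) (start i)).
  by rewrite {1}kE iterS.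
rewrite iter_start // -?kE //.
have -> : B i k.-1 = V i 1.
  rewrite /B; have -> : (k.-1 <= l (i.+1 %% t))%N = false by lia.
  by congr V; lia.
have -> : B i k = u.
  rewrite /B; have -> : (k <= l (i.+1 %% t))%N = false by lia.
  by rewrite subnn.
by rewrite /face_next /= rot_u // /start B0 B1.
Qed.

Let traject_start i : (i < t)%N ->
  traject (face_next G) (start i) k = mkseq (fun j => (B i j, B i j.+1)) k.
Proof.
move=> it; apply: (@eq_from_nth _ (start i)); rewrite size_traject ?size_mkseq // => j jk.
by rewrite nth_traject // nth_mkseq // iter_start.
Qed.

Let B_uniq i : (i < t)%N -> uniq (mkseq (B i) k).
Proof.
move=> it; have lk' := lk it; have ne := modn_succ_neq (ltnW (ltnW t4)) it.
have i1t := succ_lt i.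
apply/mkseq_uniqP.
have cross j j' : (j <= l (i.+1 %% t))%N -> (l (i.+1 %% t) < j' < k)%N -> B i j <> B i j'.
  move=> jl jl'; rewrite /B jl; have -> : (j' <= l (i.+1 %% t))%N = false by lia.
  have ij' : inside i (k - j') by rewrite /inside it /=; lia.
  have /andP[/eqP nu /eqP nw] := V_pole ij'.
  have [->|j0] := posnP j; first by move/esym.
  have [jE|jl1] := eqVneq j (l (i.+1 %% t)); first by rewrite jE Vl; move/esym.
  have ij : inside (i.+1 %% t) j by rewrite /inside i1t /=; lia.
  by move=> /(V_inj ij ij')[/esym/ne].
move=> j j'; rewrite !inE => jk jk'.
have [jl|jl] := leqP j (l (i.+1 %% t)); have [jl'|jl'] := leqP j' (l (i.+1 %% t)).
- by rewrite /B jl jl' => /(V_path_inj i1t jl jl').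
- by move/cross => []; rewrite ?jl'.
- by move/esym/cross => []; rewrite ?jl.
rewrite /B leqNgt jl leqNgt jl' /= => /(V_path_inj it); lia.
Qed.

(** A dart of path i directed towards [w] lies on face i - 1, and one directed towards [u] on face
    i. *)
Let dart_face d : d \in darts G -> exists i j, [/\ (i < t)%N, (j < k)%N & d = (B i j, B i j.+1)].
Proof.
case: d => x y; rewrite inE => /(@nbrsP x y)[i' [j [it jl [[-> ->]|[-> ->]]]]].
  have itE : (((i' + t).-1 %% t).+1 %% t = i')%N.
    rewrite -addn1 modnDml addn1 prednK ?modnDr ?modn_small //; lia.
  have i0t : ((i' + t).-1 %% t < t)%N by rewrite ltn_mod; lia.
  exists ((i' + t).-1 %% t)%N, j; split=> //; first by have := lk i0t; rewrite itE; lia.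
  by rewrite /B itE jl ltnW.
have lk' := lk it; exists i', (k - j.+1)%N; split=> //; first by lia.
rewrite /B; have -> : ((k - j.+1).+1 <= l (i'.+1 %% t))%N = false by lia.
have -> : (k - (k - j.+1).+1)%N = j by lia.
congr pair; case: leqP => jl'; last by congr V; lia.
have -> : j.+1 = l i' by lia.
have -> : (k - l i')%N = l (i'.+1 %% t) by lia.
by rewrite !Vl.
Qed.

Let face_walk_rot d : d \in darts G ->
  exists i r, (i < t)%N /\ face_walk G d = seq.rot r (mkseq (B i) k).
Proof.
move=> /dart_face[i [j [it jk ->]]]; exists i.
have U : uniq (traject (face_next G) (start i) k).
  by rewrite traject_start //; apply: (@map_uniq _ _ fst); rewrite -map_comp; exact: B_uniq.
have [|r rE] := orbit_traject (ltn_trans (isT : 0 < 3) k_gt3) (iter_k it) U (y := (B i j, B i j.+1)).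
  by rewrite traject_start // (map_f (fun j => (B i j, B i j.+1))) // mem_iota.
by exists r; rewrite /face_walk rE map_rot traject_start // -map_comp.
Qed.

Let walk_size d : d \in darts G -> size (face_walk G d) = k.
Proof. by case/face_walk_rot => i [r [_ ->]]; rewrite size_rot size_mkseq. Qed.

Let degreeE v : #|[set a | adj G v a]| = if (v == u) || (v == w) then t else 2.
Proof.
have -> : #|[set a | adj G v a]| = size (nbrs v).
  by rewrite -(card_uniqP (nbrs_uniq v)); apply: eq_card => a; rewrite inE.
move: v; apply: V_cases => [||i j ij].
- by rewrite nbrs_u size_mkseq eqxx.
- by rewrite nbrs_w size_rev size_mkseq eqxx orbT.
by rewrite nbrs_V //; have /andP[/negPf-> /negPf->] := V_pole ij.
Qed.

(** Sum of degrees: t at each pole and 2 at the n - 2 other vertices. As all walks have length k,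
    this yields t faces and hence Euler's formula. *)
Let darts_count : #|darts G| = (t * k)%N.
Proof.
rewrite -sum1_card (partition_big fst xpredT) //=.
rewrite (eq_bigr (fun v => if (v == u) || (v == w) then t else 2)) => [|v _]; last first.
  rewrite -degreeE -sum1dep_card (reindex_onto (fun a => (v, a)) snd) /=.
    by apply: eq_bigl => a; rewrite inE /= !eqxx !andbT.
  by case=> x y /andP[_ /eqP /= <-].
rewrite (bigD1 u) //= eqxx (bigD1 w) ?(eq_sym w) //= eqxx orbT.
rewrite (eq_bigr (fun=> 2)) => [|v /andP[/negPf-> /negPf->] //].
rewrite sum_nat_const; have -> : #|[pred v | (v != u) && (v != w)]| = (n - 2)%N.
  have := cardsC [set u; w]; rewrite cards2 uw card_ord => nE.
  rewrite -[RHS](_ : #|~: [set u; w]| = _); last by lia.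
  by apply: eq_card => v; rewrite !inE negb_or.
have : (t * k = t * (k - 2) + t * 2)%N by rewrite -mulnDr subnK // ltnW // ltnW.
by rewrite tn; lia.
Qed.

Let faces_count : #|faces G| = t.
Proof.
have := card_darts_faces walk_size; rewrite darts_count mulnC => /eqP.
by rewrite eqn_pmul2l ?(ltn_trans _ k_gt3) // => /eqP.
Qed.

Let off (X : {set 'I_n}) := [rel a b | [&& adj G a b, a \notin X & b \notin X]].

Let off_sym X : connect_sym (off X).
Proof.
by apply: sym_connect_sym => a b; apply: (congr2 andb); [exact: adj_sym | exact: andbC].
Qed.

Let connect_path (X : {set 'I_n}) i j j' : (i < t)%N -> (j <= j' <= l i)%N ->
  (forall m, (j <= m <= j')%N -> V i m \notin X) -> connect (off X) (V i j) (V i j').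
Proof.
move=> it /andP[jj']; rewrite -(subnK jj'); elim: (j' - j)%N => [|m IH] ml out; first exact: connect0.
rewrite addSn; apply: connect_trans (IH _ _) (connect1 _); first by rewrite ltnW.
  by move=> q /andP[jq qm]; apply: out; lia.
apply/and3P; split; [|by apply: out; lia|by apply: out; lia].
by have /andP[] := nbrs_step it ml.
Qed.

Let on_path v : exists i j, [/\ (i < t)%N, (j <= l i)%N & v = V i j].
Proof.
have t0 : (0 < t)%N by exact: leq_trans t4.
move: v; apply: V_cases => [||i j /and3P[it j0 jl]].
- by exists 0%N, 0%N.
- by exists 0%N, (l 0); rewrite Vl.
by exists i, j; split=> //; exact: ltnW.
Qed.

(** Every remaining vertex reaches [u], or [w] if [u] is removed, along its own path; if [x] blocks
    the way to [u], the detour goes on to [w] and back along the next path. *)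
Let connected_off_sub1 (X : {set 'I_n}) (x : 'I_n) : X \subset [set x] -> connected_off G X.
Proof.
move=> Xx; have inX y : y \in X -> y = x by move/(fintype.subsetP Xx); rewrite inE => /eqP.
suff [r rP] : exists r, forall v, v \notin X -> connect (off X) v r.
  by move=> a b aX bX; rewrite (connect_trans (rP a aX)) // off_sym rP.
have [xu|xu] := eqVneq x u.
  exists w => v vX; have [i [j [it jl vE]]] := on_path v.
  rewrite vE -(Vl i); apply: connect_path => // [|m /andP[jm ml]]; first by rewrite jl /=.
  have [->|ne] := eqVneq m j; first by rewrite -vE.
  apply/negP => /inX; rewrite xu -(V0 i) => /(V_path_inj it ml) => /(_ isT); lia.
have uX : u \notin X by apply: contraNN xu => /inX ->.
exists u => v vX; have [i [j [it jl vE]]] := on_path v.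
have [xv|xv] := boolP (x \in X); last first.
  have X0 y : y \notin X by apply: contraNN xv => yX; rewrite -(inX y yX).
  by rewrite off_sym vE -(V0 i); apply: connect_path.
have [/existsP[m /eqP mE]|none] := boolP [exists m : 'I_j.+1, V i m == x]; last first.
  rewrite off_sym vE -(V0 i); apply: connect_path => // m /andP[_ mj].
  apply: contraNN none => /inX mx; apply/existsP.
  by exists (Ordinal (mj : (m < j.+1)%N)); rewrite /= mx.
have mj : (m < j)%N.
  rewrite ltn_neqAle -ltnS ltn_ord andbT; apply: contraNneq vX => mj.
  by rewrite vE -mj mE.
have m0 : (0 < m)%N by rewrite lt0n; apply: contraNneq xu => m0; rewrite -mE m0.
have mi : inside i m by rewrite /inside it m0 (leq_trans mj).
have ne := modn_succ_neq (ltnW (ltnW t4)) it.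
apply: (@connect_trans _ _ w).
  rewrite vE -(Vl i); apply: connect_path => // [|q /andP[jq ql]]; first by rewrite jl /=.
  apply/negP => /inX; rewrite -mE => /(V_path_inj it ql) => /(_ (ltnW (leq_trans mj jl))) qm.
  by rewrite qm leqNgt mj in jq.
have i1t := succ_lt i.
rewrite off_sym -(V0 (i.+1 %% t)) -(Vl (i.+1 %% t)); apply: connect_path; rewrite ?leqnn // => q /andP[_ ql].
apply/negP => /inX; rewrite -mE.
have /andP[/eqP nu /eqP nw] := V_pole mi.
have [->|q0] := posnP q; first by move/esym.
have [->|ql'] := eqVneq q (l (i.+1 %% t)); first by rewrite Vl; move/esym.
have qi : inside (i.+1 %% t) q by rewrite /inside i1t q0 ltn_neqAle ql' ql.
by case/(V_inj qi mi) => /esym.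
Qed.

Lemma theta_graph_exists : exists H : hypergraph n,
  planar_hypergraph k H /\ theta_hypergraph k t (l 0) H.
Proof.
have t0 : (0 < t)%N by exact: leq_trans t4.
have Gk : closed_angulation G k.
  split.
  - split; first by apply: (@connected_off_sub1 _ u); rewrite finset.sub0set.
    have := card_darts G; rewrite darts_count faces_count.
    have : (t * k = t * (k - 2) + t * 2)%N by rewrite -mulnDr subnK // ltnW // ltnW.
    by rewrite tn; lia.
  - split=> [|X X1].
      have : (2 * (n - 2) != 0)%N; last by case: (n - 2)%N (subn_gt0 2 n) => // m <-.
      by rewrite -tn muln_eq0 negb_or -!lt0n t0 subn_gt0 ltnW.
    have [X0|X0] := posnP #|X|.
      by rewrite (cards0_eq X0); apply: (@connected_off_sub1 _ u); rewrite finset.sub0set.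
    have /cards1P[x ->] : #|X| == 1%N by rewrite eqn_leq X0 -ltnS X1.
    by apply: (@connected_off_sub1 _ x).
  - move=> d dG; rewrite walk_size //; split=> //; apply/andP; split; first exact: face_walk_cycle.
    by have [i [r [it ->]]] := face_walk_rot dG; rewrite rot_uniq B_uniq.
have k3 : (2 < k)%N by exact: ltnW.
have poles F : F \in faces G -> (u \in face_vertices F) && (w \in face_vertices F).
  case/facesP => d dG ->; have [i [r [it dE]]] := face_walk_rot dG.
  have mem_walk x : x \in face_walk G d -> x \in face_vertices (face_of G d).
    by case/mapP => c cO ->; apply/imsetP; exists c; rewrite // inE.
  apply/andP; split; apply: mem_walk; rewrite dE mem_rot; apply/mapP.
    by exists 0%N; rewrite ?B0 // mem_iota (ltn_trans _ k_gt3).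
  exists (l (i.+1 %% t)); rewrite ?Bw // mem_iota.
  by have := lk it; have := l1 i; lia.
have uV : adj G u (V 0 1).
  by have /andP[] := @nbrs_step 0 0 t0 (ltnW (l1 _)).
have t4' : (3 < #|faces G|)%N by rewrite faces_count.
(* The labelling comes from the structure result applied to this graph. It remains to see that the
   path through [V 0 1] has length [l 0], which the face between the paths t - 1 and 0 shows. *)
have := two_poles_theta Gk k3 t4' uw poles uV; rewrite faces_count => theta.
exists (face_hypergraph G); split; first by exists G.
suff -> : l 0 = index w (face_walk G (u, V 0 1)) by [].
have t1 : (t.-1 < t)%N by rewrite prednK.
have sE : start t.-1 = (u, V 0 1) by rewrite /start B0 B1 prednK // modnn.
have uVG : (u, V 0 1) \in darts G by rewrite inE.
apply: (walk_pole_index Gk poles uVG).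
  by have := lk t1; have := l1 t.-1; rewrite prednK // modnn; lia.
rewrite -sE iter_start //; first by have := Bw t.-1; rewrite prednK // modnn.
by have := lk t1; have := l1 t.-1; rewrite prednK // modnn; lia.
Qed.

End ThetaGraph.

(** * The spectral maxima are the planar theta hypergraphs *)

Section Extremal.
Local Open Scope ring_scope.
Variables (R : realType) (k n t : nat).
Hypotheses (k5 : (5 < k)%N) (t4 : (3 < t)%N) (tn : (t * (k - 2) = 2 * (n - 2))%N).

Lemma positive_root (c : R) (m : nat) : (0 < m)%N -> 0 < c -> exists2 s, 0 < s & s ^+ m = c.
Proof.
move=> m0 c0; exists (powR c m%:R^-1); first exact: powR_gt0.
by rewrite -powR_mulrn ?powR_ge0 // -powRrM mulVf ?powRr1 ?pnatr_eq0 -?lt0n // ltW.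
Qed.

Let k2 : (2 < k)%N. Proof. exact: ltn_trans k5. Qed.

Let n2 : (1 < n)%N.
Proof.
have : (2 * (n - 2) != 0)%N; last by rewrite muln_eq0 /= subn_eq0 -ltnNge => /ltnW.
by rewrite -tn muln_eq0 negb_or -!lt0n subn_gt0 k2 (ltn_trans _ t4).
Qed.

Lemma angulation_face_count (G : embedded_graph n) : closed_angulation G k -> #|faces G| = t.
Proof.
move=> /angulation_card_faces/(_ k2); rewrite -tn => /eqP.
by rewrite eqn_pmul2r ?subn_gt0 // => /eqP.
Qed.

Lemma odd_faces_half : odd t -> (2 * k./2)%N = k.
Proof.
move=> ot; have ek : ~~ odd k.
  have := congr1 odd tn; rewrite !oddM ot /= oddB; last exact: ltnW.
  by rewrite addbF => ->.
by have := odd_double_half k; rewrite (negPf ek) add0n -mul2n.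
Qed.

Lemma planar_spectral_radius : exists2 lam : R,
  (forall H : hypergraph n, planar_hypergraph k H -> spectral_radius R k H <= lam /\
     (spectral_radius R k H = lam ->
      exists a, [/\ (1 < a)%N, (2 * a <= k)%N, odd t -> (2 * a)%N = k & theta_hypergraph k t a H])) &
  (forall a (H : hypergraph n), (1 < a)%N -> (2 * a <= k)%N -> (odd t -> (2 * a)%N = k) ->
     planar_hypergraph k H -> theta_hypergraph k t a H -> spectral_radius R k H = lam).
Proof.
have kR : 0 < k%:R :> R by rewrite ltr0n; exact: ltn_trans k2.
have tR : 0 < t%:R :> R by rewrite ltr0n; exact: ltn_trans t4.
have k0 : (0 < k)%N by exact: ltn_trans k2.
have [s s0 sE] : exists2 s : R, 0 < s & s ^+ k = k%:R^-1 by apply: positive_root; rewrite ?invr_gt0.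
have [z z0 zE] : exists2 z : R, 0 < z & z ^+ k = (k%:R * t%:R / 2)^-1.
  by apply: positive_root; rewrite // invr_gt0 divr_gt0 // mulr_gt0.
have sk : s ^+ k * k%:R = 1 by rewrite sE mulVf // lt0r_neq0.
have zk : z ^+ k * (k%:R * t%:R / 2) = 1.
  by rewrite zE mulVf // lt0r_neq0 // divr_gt0 // mulr_gt0.
pose lam := k%:R * (s ^+ 2 * z ^+ (k - 2)) * t%:R.
have bound (H : hypergraph n) : planar_hypergraph k H -> spectral_radius R k H <= lam /\
     (spectral_radius R k H = lam ->
      exists a, [/\ (1 < a)%N, (2 * a <= k)%N, odd t -> (2 * a)%N = k & theta_hypergraph k t a H]).
  move=> [G [Gk HE]]; have tE := angulation_face_count Gk.
  have [x xU [<- _]] := @spectral_radius_max R k n H k0 (ltnW n2).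
  have Ht : (#|H| <= t)%N.
    by rewrite HE face_hypergraphE -tE leq_imset_card.
  have Hk e : e \in H -> #|e| = k by rewrite HE; exact: (card_face_hyperedge Gk).
  have cover v : exists2 e, e \in H & v \in e by rewrite HE; exact: (face_hypergraph_cover Gk v).
  have exc (S : {set 'I_n}) : (1 < #|S|)%N ->
      (\sum_(e in H) (#|e :&: S| - 2) <= 2 * (#|S| - 2))%N.
    by rewrite HE; exact: (face_hypergraph_excess Gk).
  have [le eq] := extremal_bound k2 (ltnW t4) s0 z0 sk zk tn n2 Hk Ht cover exc xU.
  split=> // /eq[u [w [uw poles]]].
  have t4' : (3 < #|faces G|)%N by rewrite tE.
  rewrite HE in poles *; rewrite -tE.
  exact: two_poles_angulation poles.
exists lam => // a H a1 ak oddt pH [c [clt ccard HE]].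
apply/eqP; rewrite eq_le (bound H pH).1 /=.
have [x xU xE] := theta_attains t4 a1 ak oddt clt ccard HE s0 z0 sk zk tn.
rewrite /lam -xE.
by have [_ _ [_ ub]] := @spectral_radius_max R k n H k0 (ltnW n2); exact: ub.
Qed.

Lemma planar_theta_exists a : (1 < a)%N -> (2 * a <= k)%N -> (odd t -> (2 * a)%N = k) ->
  exists H : hypergraph n, planar_hypergraph k H /\ theta_hypergraph k t a H.
Proof.
(* For even t the alternation closes up. For odd t the adjacent paths t - 1 and 0 both have length
   a, and 2a = k gives their face length k. *)
move=> a1 ak oddt; pose l i := if odd i then (k - a)%N else a.
apply: (@theta_graph_exists n k t l) => // [i|i it].
  by rewrite /l; case: odd => //; lia.
rewrite modn_succ //; case: eqP => [tE|_]; last by rewrite /l /=; case: odd => /=; lia.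
by move: oddt; rewrite -tE /l /=; case: odd => /= [_|/(_ isT)]; lia.
Qed.

Lemma spectral_maximum_theta (H : hypergraph n) : spectral_maximum R k H <->
  planar_hypergraph k H /\
  exists a, [/\ (1 < a)%N, (2 * a <= k)%N, odd t -> (2 * a)%N = k & theta_hypergraph k t a H].
Proof.
have [lam bound attained] := planar_spectral_radius.
split=> [[pH maxH]|[pH [a [a1 ak oddt thH]]]]; last first.
  split=> // H' pH'; rewrite (attained a H) //; exact: (bound H' pH').1.
split=> //; apply: (bound H pH).2; apply/eqP; rewrite eq_le (bound H pH).1 /=.
(* To see that [lam] is attained, some valid parameter is needed: k/2 for odd t, 2 for even t. *)
have [a [a1 ak oddt]] : exists a, [/\ (1 < a)%N, (2 * a <= k)%N & odd t -> (2 * a)%N = k].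
  have [/odd_faces_half kE|et] := boolP (odd t); last by exists 2; split=> //; lia.
  by exists k./2; split=> //; lia.
have [H' [pH' thH']] := planar_theta_exists a1 ak oddt.
by rewrite -(attained a H') //; exact: maxH.
Qed.

End Extremal.

Theorem corollary1p5 (R : realType) (k : nat) (hk : (6 <= k)%N) :
  exists N : nat, forall n : nat, (N <= n)%N -> admissible k n ->
    let t := (2 * (n - 2) %/ (k - 2))%N in
    (~~ odd t ->
       exactly_up_to_iso ((k - 2) %/ 2)%N
         (fun H : hypergraph n => spectral_maximum R k H)) /\
    (odd t ->
       exactly_up_to_iso 1%N
         (fun H : hypergraph n => spectral_maximum R k H)).
Proof.
(* From n >= 2k it follows that t >= 4, as the structure result requires. *)
exists (2 * k)%N => n kn /andP[_ dvd] t.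
have tn : (t * (k - 2) = 2 * (n - 2))%N by rewrite /t divnK.
have t4 : (3 < t)%N.
  by rewrite /t leq_divRL; lia.
have maxP H := spectral_maximum_theta R hk t4 tn H.
split=> [et|ot].
(* The i-th hypergraph has parameter i + 2, so the indices below (k - 2) / 2 cover 2 <= a <= k/2. *)
- have /boolp.choice[F FP] (i : 'I_((k - 2) %/ 2)) : exists H : hypergraph n,
      planar_hypergraph k H /\ theta_hypergraph k t i.+2 H.
    apply: planar_theta_exists => //; last by rewrite (negPf et).
    by have := ltn_ord i; lia.
  have ik (i : 'I_((k - 2) %/ 2)) : (2 * i.+2 <= k)%N by have := ltn_ord i; lia.
  exists F; split=> [i|i j|H /maxP[_ [a [a1 ak _ thH]]]].
  + by apply/maxP; have [pF thF] := FP i; split=> //; exists i.+2; split=> //; rewrite (negPf et).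
  + have [[_ thi] [_ thj]] := (FP i, FP j).
    by move/(theta_isomorphic_eq t4 (isT : 1 < i.+2) (ik i) (isT : 1 < j.+2) (ik j) et thi thj) => -[] /val_inj.
  + have ai : (a - 2 < (k - 2) %/ 2)%N by lia.
    exists (Ordinal ai); apply: theta_isomorphic thH _.
    by have [_] := FP (Ordinal ai); rewrite /= -addn2 subnK.
have kE := odd_faces_half hk tn ot.
have [H [pH thH]] : exists H : hypergraph n, planar_hypergraph k H /\ theta_hypergraph k t k./2 H.
  by apply: planar_theta_exists => //; lia.
exists (fun=> H); split=> [_|i j _|H' /maxP[_ [a [_ _ /(_ ot) aE thH']]]].
- by apply/maxP; split=> //; exists k./2; split=> //; lia.
- by rewrite !ord1.
exists ord0; apply: theta_isomorphic thH' _.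
by have -> : a = k./2 by rewrite -aE mul2n doubleK.
Qed.
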